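(* Let $G$ be $GL_n(\mathbb{C})$ or $SL_n(\mathbb{C})$ with Lie algebra $\mathfrak{g}$, and let $N\in\mathfrak{g}$ be a fixed nilpotent element. Let $B'$ be the Borel subgroup of all matrices in $G$ that are upper triangular with respect to a basis of $\mathbb{C}^n$ which puts $N$ in Jordan canonical form. Then there exists a permutation $\sigma$ (of this basis) such that the Borel subgroup $B=\sigma^{-1}\cdot B'=\sigma^{-1}B'\sigma$ induces a Bruhat decomposition whose Schubert cells intersect each Hessenberg variety $\mathcal{H}(N,H)$ (for every Hessenberg space $H$ with respect to the Lie algebra of $B$) in a paving by affines. The nonempty cells are those $B\pi B\cap\mathcal{H}(N,H)$ with $\pi^{-1}\cdot N\in H$, and they have dimension $$|\Phi_\pi|-|\mathcal{C}_{\pi\cdot H}\cap\Phi_{U_\pi\cdot N}|.$$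
   Context: Let $\mathfrak{b}$ be the Lie algebra of $B$, $\mathfrak{h}\subset\mathfrak{b}$ the Cartan subalgebra of matrices diagonal in the given basis, $\mathfrak{g}=\mathfrak{h}\oplus\bigoplus_{\alpha\in\Phi}\mathfrak{g}_\alpha$ the root decomposition, $\Phi^+$ the roots occurring in $\mathfrak{b}$, $\Phi^-=-\Phi^+$, $W$ the Weyl group (permutations of the basis), $U$ the unipotent radical of $B$ and $U^-$ the opposite unipotent group. Write $g\cdot X=\mathrm{Ad}\,g(X)=gXg^{-1}$. A Hessenberg space is a subspace $H$ with $\mathfrak{b}\subseteq H\subseteq\mathfrak{g}$ and $[\mathfrak{b},H]\subseteq H$. Put $\mathcal{M}_H=\{\alpha\in\Phi:\mathfrak{g}_\alpha\subseteq H\}$. The Hessenberg variety is $\mathcal{H}(N,H)=\{gB\in G/B: g^{-1}\cdot N\in H\}$. $B\pi B$ also denotes the Schubert cell in $G/B$. A paving of a variety $X$ is an ordered partition $(\mathcal{P}_1,\mathcal{P}_2,\ldots)$ of $X$ into disjoint subvarieties such that each finite union $\bigcup_{j\le i}\mathcal{P}_j$ is closed in $X$; it is a paving by affines if each $\mathcal{P}_i$ is isomorphic to an affine space. Here the parts are the nonempty sets $B\pi B\cap\mathcal{H}(N,H)$, in a suitable order. Notation: $\Phi_\pi=\Phi^+\cap\pi\Phi^-$; $U_\pi=\{u\in U:\pi^{-1}u\pi\in U^-\}$; $\mathcal{C}_{\pi\cdot H}=\Phi^+\setminus\pi\mathcal{M}_H$. For $X\in\mathfrak{g}$, $\Phi_X$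 is the set of roots $\alpha$ for which $X$ has nonzero component in $\mathfrak{g}_\alpha$; for a subset $\mathfrak{u}\subseteq\mathfrak{g}$, $\Phi_{\mathfrak{u}}=\bigcup_{X\in\mathfrak{u}}\Phi_X$; and $U_\pi\cdot N=\{u\cdot N:u\in U_\pi\}$. *)

(* Defs.v *)
From mathcomp Require Import all_boot all_order all_fingroup all_algebra.
From mathcomp Require Import boolp classical_sets reals.
From mathcomp Require Import complex.
From mathcomp Require mpoly.

Set Implicit Arguments.
Unset Strict Implicit.
Unset Printing Implicit Defensive.

Import Order.TTheory GRing.Theory Num.Theory.
Local Open Scope classical_set_scope.
Local Open Scope ring_scope.

(* A variety over K is represented by its set of closed points inside an
   ambient type T, its Zariski-closed subsets, and its sheaf of K-valued regular
   functions: [regular X U f] says that [f], of which only the values on U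
   matter, is a regular function on the open subset U of X. *)

Record space_with_functions (K : fieldType) (T : Type) := SpaceWithFunctions {
  points : set T;
  zclosed : set (set T);
  regular : set T -> set (T -> K) }.

Section Spaces.
Variable K : fieldType.

Definition zopen T (X : space_with_functions K T) : set (set T) :=
  [set U | U `<=` points X /\ zclosed X (points X `\` U)].

(* Points of T have coordinates in K^d; regular functions are locally quotients
   of polynomial functions. *)
Definition coordinate_space d T (coord : T -> 'I_d -> K) :
    space_with_functions K T :=
  let zclosed_in (Z : set T) := exists I : set (mpoly.mpoly d K),
    Z = [set x | forall p, I p -> mpoly.meval (coord x) p = 0] in
  SpaceWithFunctions setT zclosed_in
    (fun U => [set f | zclosed_in (~` U) /\
      forall x, U x -> exists p q : mpoly.mpoly d K,
        mpoly.meval (coord x) q != 0 /\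
        forall y, U y -> mpoly.meval (coord y) q != 0 ->
          f y = mpoly.meval (coord y) p / mpoly.meval (coord y) q]).

Definition affine_space d : space_with_functions K 'rV[K]_d :=
  coordinate_space (fun (x : 'rV[K]_d) i => x 0 i).

Definition matrix_space n : space_with_functions K 'M[K]_n :=
  coordinate_space (fun (A : 'M[K]_n) i => mxvec A 0 i).

(* The induced structure on A : regular functions on A are those which locally
   extend to regular functions on open subsets of X. For A locally closed in
   a variety X, this is the reduced subvariety A. *)
Definition subspace T (X : space_with_functions K T) (A : set T) :
    space_with_functions K T :=
  let zclosed_in (Z : set T) := exists2 Z', zclosed X Z' & Z = A `&` Z' in
  SpaceWithFunctions (points X `&` A) zclosed_in
    (fun U => [set f |
      [/\ U `<=` points X `&` A, zclosed_in ((points X `&` A) `\` U)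
        & forall x, U x -> exists V g,
            [/\ zopen X V, regular X V g, V x
              & forall y, U y -> V y -> f y = g y]]]).

Definition quotient_space T S (X : space_with_functions K T) (q : T -> S) :
    space_with_functions K S :=
  SpaceWithFunctions (q @` points X)
    [set Z | Z `<=` q @` points X /\ zclosed X (points X `&` q @^-1` Z)]
    (fun V => [set f : S -> K | V `<=` q @` points X /\
                       regular X (points X `&` q @^-1` V) (f \o q)]).

Definition is_morphism T S (X : space_with_functions K T)
    (Y : space_with_functions K S) (f : T -> S) : Prop :=
  [/\ forall x, points X x -> points Y (f x),
      forall Z, zclosed Y Z -> zclosed X (points X `&` f @^-1` Z)
    & forall V h, zopen Y V -> regular Y V h ->
        regular X (points X `&` f @^-1` V) (h \o f)].

Definition isomorphic T S (X : space_with_functions K T)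
    (Y : space_with_functions K S) : Prop :=
  exists (f : T -> S) (g : S -> T),
    [/\ is_morphism X Y f, is_morphism Y X g,
        forall x, points X x -> g (f x) = x
      & forall y, points Y y -> f (g y) = y].

Definition locally_closed T (X : space_with_functions K T) (A : set T) : Prop :=
  exists Z1 Z2, [/\ zclosed X Z1, zclosed X Z2 & A = Z1 `\` Z2].

Definition paving T (X : space_with_functions K T) m (part : 'I_m -> set T) :
    Prop :=
  [/\ points X = \bigcup_i part i,
      trivIset setT part,
      forall i, part i !=set0,
      forall i, locally_closed X (part i)
    & forall i, zclosed X (\bigcup_(j in [set j : 'I_m | (j <= i)%N]) part j)].

Definition paving_by_affines T (X : space_with_functions K T) m
    (part : 'I_m -> set T) : Prop :=
  paving X part /\
  forall i, exists d, isomorphic (subspace X (part i)) (affine_space d).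

End Spaces.

Definition jordan_block (K : fieldType) m (lambda : K) : 'M[K]_m :=
  \matrix_(i, j) (lambda *+ (i == j) + (j == i.+1 :> nat)%:R).

Definition jordan_form (K : fieldType) n (A : 'M[K]_n) : Prop :=
  exists (r : nat) (m : 'I_r -> nat) (lambda : 'I_r -> K)
         (e : (\sum_i m i)%N = n),
    (forall i, (0 < m i)%N) /\
    A = castmx (e, e) (\mxdiag_i jordan_block (m i) (lambda i)).

Definition nilpotent_mx (K : fieldType) n (A : 'M[K]_n) : Prop :=
  exists k : nat, A ^+ k = 0.

(* An ordered basis of K^n is an invertible matrix Q, whose columns are the
   basis vectors; the matrix of X with respect to this basis is
   [coords Q X]. *)

Inductive linear_group := GL | SL.

Section LinearGroups.
Variables (K : fieldType) (n : nat) (k : linear_group).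
Implicit Types (Q g X N : 'M[K]_n) (H : {vspace 'M[K]_n}) (w : 'S_n).
Implicit Types a : 'I_n * 'I_n.

Definition group_set : set 'M[K]_n :=
  match k with
  | GL => [set g | g \in unitmx]
  | SL => [set g | \det g = 1]
  end.

Definition lie_algebra : set 'M[K]_n :=
  match k with
  | GL => setT
  | SL => [set X | \tr X = 0]
  end.

Definition Ad g X := g *m X *m invmx g.

Definition coords Q X := invmx Q *m X *m Q.

Definition upper_mx (A : 'M[K]_n) : bool := is_trig_mx A^T.

Definition borel Q : set 'M[K]_n :=
  [set g | group_set g /\ upper_mx (coords Q g)].

Definition borel_algebra Q : set 'M[K]_n :=
  [set X | lie_algebra X /\ upper_mx (coords Q X)].

Definition unipotent Q : set 'M[K]_n :=
  [set u | [/\ group_set u, upper_mx (coords Q u)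
             & forall i, coords Q u i i = 1]].

Definition opposite_unipotent Q : set 'M[K]_n :=
  [set u | [/\ group_set u, is_trig_mx (coords Q u)
             & forall i, coords Q u i i = 1]].

(* The linear map sending the j-th vector of the basis Q to the (w j)-th: the
   matrix [perm_mx w^-1] has its ones at the positions (w j, j). *)
Definition weyl_mx Q w : 'M[K]_n := Q *m perm_mx w^-1 *m invmx Q.

(* The representatives of w in the normalizer of the torus. Permutation
   matrices do not suffice, since those of odd permutations are not in SL_n. *)
Definition weyl_coset Q w : set 'M[K]_n :=
  [set g | group_set g /\ exists t : 'rV[K]_n, g = weyl_mx Q w *m Ad Q (diag_mx t)].

(* The basis obtained by applying the inverse of the permutation w of the basis
   vectors to Q; its Borel subgroup is w^-1 B' w, where B' is that of Q. *)
Definition permute_basis Q w : 'M[K]_n := invmx (weyl_mx Q w) *m Q.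

Lemma borel_permute_basis Q w : Q \in unitmx ->
  borel (permute_basis Q w) =
  [set invmx (weyl_mx Q w) *m b *m weyl_mx Q w | b in borel Q].
Proof.
move=> Qu; have su : weyl_mx Q w \in unitmx.
  by rewrite /weyl_mx !unitmx_mul Qu unitmx_perm unitmx_inv Qu.
rewrite /permute_basis; move: (weyl_mx Q w) su => s su.
have invQ : invmx (invmx s *m Q) = invmx Q *m s.
  have Mu : invmx s *m Q \in unitmx by rewrite unitmx_mul unitmx_inv su.
  by rewrite -[RHS](mulKmx Mu) -mulmxA mulKVmx// mulVmx// mulmx1.
have coordsE b : coords (invmx s *m Q) b = coords Q (s *m b *m invmx s).
  by rewrite /coords invQ !mulmxA.
have conjK b : invmx s *m (s *m b *m invmx s) *m s = b.
  by rewrite -!mulmxA mulVmx// mulmx1 mulKmx.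
have conjKV b : s *m (invmx s *m b *m s) *m invmx s = b.
  by rewrite -!mulmxA mulmxV// mulmx1 mulKVmx.
have det_conj b : \det (s *m b *m invmx s) = \det b.
  rewrite !det_mulmx mulrAC -det_mulmx mulmxV// det1; exact: mul1r.
have grp_conj b : group_set (s *m b *m invmx s) = group_set b.
  by rewrite /group_set; case: k => /=; rewrite ?unitmxE det_conj.
apply/seteqP; split => [b [Gb ub]|_ [b [Gb ub] <-]].
  exists (s *m b *m invmx s); last exact: conjK.
  by split; rewrite ?grp_conj -?coordsE.
by split; rewrite ?coordsE ?conjKV// -grp_conj conjKV.
Qed.

Definition coset Q g : set 'M[K]_n := [set g *m b | b in borel Q].

Definition flag_variety Q : space_with_functions K (set 'M[K]_n) :=
  quotient_space (subspace (matrix_space K n) group_set) (coset Q).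

Definition schubert_cell Q w : set (set 'M[K]_n) :=
  [set x | exists b1 g b2,
     [/\ borel Q b1, weyl_coset Q w g, borel Q b2
       & x = coset Q (b1 *m g *m b2)]].

Definition hessenberg_variety Q N H : set (set 'M[K]_n) :=
  [set x | exists g, [/\ group_set g, Ad (invmx g) N \in H & x = coset Q g]].

Definition hessenberg_space Q H : Prop :=
  [/\ forall X, borel_algebra Q X -> X \in H,
      forall X, X \in H -> lie_algebra X
    & forall X Y, borel_algebra Q X -> Y \in H -> X *m Y - Y *m X \in H].

(* The root e_i - e_j with respect to the basis Q is encoded as the pair (i, j),
   and W acts by (i, j) |-> (w i, w j). *)

Definition roots : {set 'I_n * 'I_n} := [set a | a.1 != a.2]%SET.

Definition root_space Q a : {vspace 'M[K]_n} :=
  <[Ad Q (delta_mx a.1 a.2)]>%VS.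

Definition opp_root a := (a.2, a.1).

Definition weyl_act w a := (w a.1, w a.2).

Definition positive_roots Q : {set 'I_n * 'I_n} :=
  [set a in roots |
     `[< forall X, X \in root_space Q a -> borel_algebra Q X >]]%SET.

Definition negative_roots Q : {set 'I_n * 'I_n} :=
  (opp_root @: positive_roots Q)%SET.

Definition hessenberg_roots Q H : {set 'I_n * 'I_n} :=
  [set a in roots | (root_space Q a <= H)%VS]%SET.

Definition Phi_perm Q w : {set 'I_n * 'I_n} :=
  (positive_roots Q :&: weyl_act w @: negative_roots Q)%SET.

Definition U_perm Q w : set 'M[K]_n :=
  [set u | unipotent Q u /\
           opposite_unipotent Q (Ad (invmx (weyl_mx Q w)) u)].

Definition C_perm Q w H : {set 'I_n * 'I_n} :=
  (positive_roots Q :\: weyl_act w @: hessenberg_roots Q H)%SET.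

Definition Phi_of Q X : {set 'I_n * 'I_n} :=
  [set a in roots | coords Q X a.1 a.2 != 0]%SET.

Definition Phi_of_set Q (u : set 'M[K]_n) : {set 'I_n * 'I_n} :=
  [set a | `[< exists2 X, u X & a \in Phi_of Q X >]]%SET.

End LinearGroups.

Arguments group_set {K n} k.
Arguments lie_algebra {K n} k.
Arguments roots {n}.

(* Main.v *)
(* In a suitably permuted Jordan basis, N sends the j-th basis vector to the
   (sh j)-th one or to 0, where the partial map sh is strictly increasing,
   satisfies sh j < j, and is defined on a final segment of the indices. A point
   of the Schubert cell of w is u w B with a unique u in U_w; put Y = u^-1 and
   X = Y N Y^-1. Membership in H(N, H) means that X_ij = 0 for (i, j) in C. Now
   X_ij = 0 unless i <= sh j, X_ij = 1 if sh j = i, and otherwise X_ij is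
   Y_{i, sh j} plus products of entries of Y in row i to the left of column sh j
   with entries of Y^-1 in the rows below i. When w^-1 N lies in H, each
   Y_{i, sh j} with (i, j) in C and i < sh j is a free coordinate of U_w, so the
   equations can be solved successively, from the bottom row up and from left to
   right: the cell is the graph of a polynomial map over the remaining
   coordinates. Its inverse chart is given by ratios of minors on the translated
   big cell. The closed unions of cells are cut out by the ranks of the lower
   left corners of g, the permutations being ordered by the sum of these ranks. *)

Require Import Defs.
From mathcomp Require Import all_boot all_order all_fingroup all_algebra.
From mathcomp Require Import boolp classical_sets reals.
From mathcomp Require Import complex.
From mathcomp Require mpoly.
From mathcomp Require Import zify ring.
(* Again, as fingroup also defines group_set and coset. *)
Import Defs.

Set Implicit Arguments.
Unset Strict Implicit.
Unset Printing Implicit Defensive.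

Import Order.TTheory GRing.Theory Num.Theory.
Local Open Scope classical_set_scope.
Local Open Scope ring_scope.

(** * Polynomial functions and closed sets *)

(** The sorted order gives every equation its pivot. If sh were undefined at j but defined at some l
    < j, the condition X_ij = 0 would be a sum of products Y_{i, sh l} (Y^-1)_{lj} without a term
    Y_{i, sh j} to solve for; if sh were not increasing, an entry Y_{i, sh l} could lie to the right
    of Y_{i, sh j} and the system would not be triangular. Ordering the Jordan basis by position in
    the block, with ties broken by index, excludes both: N lowers position and index by one each, so
    it shifts the sorting key by a constant. Back substitution is replaced by iteration: the
    solutions are the fixed points of one polynomial map, and each iteration makes at least one more
    entry final. Since G/B is given only as a quotient of G, a map into a cell is lifted to G, and a
    map out of a cell is a rational function on G invariant under B. To reach SL_n as well, a
    diagonal matrix of determinant det(w)^-1 is inserted after w. *)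

Lemma eq_zclosed (K : fieldType) T (X : space_with_functions K T) Z1 Z2 :
  zclosed X Z1 -> Z1 = Z2 -> zclosed X Z2.
Proof. by move=> + <-. Qed.

Section FunctionAlgebras.
Variables (K : fieldType) (T : Type).

(** Serves both polynomial functions and fractions over powers of a fixed denominator ([ratfun]), so
    that determinants and adjugates are treated once. *)
Definition function_algebra (S : set (T -> K)) : Prop :=
  [/\ forall c, S (fun=> c),
      forall f g, S f -> S g -> S (fun x => f x + g x)
    & forall f g, S f -> S g -> S (fun x => f x * g x)].

Variable S : set (T -> K).
Hypothesis algS : function_algebra S.

Let algC c : S (fun=> c). Proof. by case: algS. Qed.
Let algD f g : S f -> S g -> S (fun x => f x + g x).
Proof. by case: algS => _ + _; apply. Qed.
Let algM f g : S f -> S g -> S (fun x => f x * g x).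
Proof. by case: algS => _ _; apply. Qed.

Lemma function_algebra_sum I (r : seq I) (P : pred I) (F : I -> T -> K) :
  (forall i, S (F i)) -> S (fun x => \sum_(i <- r | P i) F i x).
Proof.
move=> SF; elim: r => [|i r IHr].
  by under eq_fun do rewrite big_nil; exact: algC.
under eq_fun do rewrite big_cons; case: (P i) => //; exact: algD.
Qed.

Lemma function_algebra_prod I (r : seq I) (P : pred I) (F : I -> T -> K) :
  (forall i, S (F i)) -> S (fun x => \prod_(i <- r | P i) F i x).
Proof.
move=> SF; elim: r => [|i r IHr].
  by under eq_fun do rewrite big_nil; exact: algC.
under eq_fun do rewrite big_cons; case: (P i) => //; exact: algM.
Qed.

Lemma function_algebra_opp f : S f -> S (fun x => - f x).
Proof. by move=> Sf; under eq_fun do rewrite -mulN1r; exact: algM. Qed.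

Lemma function_algebra_exp f k : S f -> S (fun x => f x ^+ k).
Proof.
move=> Sf; elim: k => [|k IHk]; first exact: algC.
by under eq_fun do rewrite exprS; exact: algM.
Qed.

Lemma function_algebra_meval d (v : T -> 'I_d -> K) (p : mpoly.mpoly d K) :
  (forall i, S (fun x => v x i)) -> S (fun x => mpoly.meval (v x) p).
Proof.
move=> Sv; under eq_fun do rewrite mpoly.mevalE.
apply: function_algebra_sum => m; apply: algM => //.
by apply: function_algebra_prod => i; exact: function_algebra_exp.
Qed.

Lemma function_algebra_mulmx m n p (A : T -> 'M_(m, n)) (B : T -> 'M_(n, p)) :
  (forall i j, S (fun x => A x i j)) -> (forall i j, S (fun x => B x i j)) ->
  forall i j, S (fun x => (A x *m B x) i j).
Proof.
move=> SA SB i j; under eq_fun do rewrite mxE.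
by apply: function_algebra_sum => k; exact: algM.
Qed.

Lemma function_algebra_det n (A : T -> 'M_n) :
  (forall i j, S (fun x => A x i j)) -> S (fun x => \det (A x)).
Proof.
move=> SA; apply: function_algebra_sum => s; apply: algM => //.
exact: function_algebra_prod.
Qed.

Lemma function_algebra_adj n (A : T -> 'M_n) :
  (forall i j, S (fun x => A x i j)) ->
  forall i j, S (fun x => (\adj (A x)) i j).
Proof.
move=> SA i j; under eq_fun do rewrite mxE /cofactor.
apply: algM => //; apply: function_algebra_det => a b.
by under eq_fun do rewrite !mxE.
Qed.

End FunctionAlgebras.

Section CoordinateSpaces.
Variables (K : fieldType) (d : nat) (T : Type) (coord : T -> 'I_d -> K).

Definition polyfun : set (T -> K) :=
  [set f | exists p, forall x, f x = mpoly.meval (coord x) p].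

Section MpolyRing.
Import mpoly.

Lemma polyfun_coord i : polyfun (fun x => coord x i).
Proof. by exists 'X_i => x; rewrite mevalXU. Qed.

Lemma polyfun_algebra : function_algebra polyfun.
Proof.
split => [c|f g [p fE] [q gE]|f g [p fE] [q gE]].
- by exists c%:MP => x; rewrite mevalC.
- by exists (p + q) => x; rewrite mevalD fE gE.
- by exists (p * q) => x; rewrite mevalM fE gE.
Qed.

End MpolyRing.

Notation X := (coordinate_space coord).

Lemma zclosed_coordinateP Z : zclosed X Z <->
  exists2 F : set (T -> K), F `<=` polyfun &
    Z = [set x | forall f, F f -> f x = 0].
Proof.
split=> [[I ->]|[F Fpoly ->]].
  exists [set f | exists2 p, I p & f = fun x => mpoly.meval (coord x) p].
    by move=> _ [p Ip ->]; exists p.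
  apply/seteqP; split=> x /= Ix => [_ [p Ip ->]|p Ip]; first exact: Ix.
  by apply: Ix (fun x => mpoly.meval (coord x) p) _; exists p.
exists [set p | F (fun x => mpoly.meval (coord x) p)].
apply/seteqP; split=> x /= Fx => [p /Fx//|f Ff].
have [p fE] := Fpoly f Ff.
by rewrite fE; apply: Fx; under eq_fun do rewrite -fE.
Qed.

Lemma regular_coordinateP U f : regular X U f <->
  zclosed X (~` U) /\ forall x, U x -> exists p q,
    [/\ polyfun p, polyfun q, q x != 0
      & forall y, U y -> q y != 0 -> f y = p y / q y].
Proof.
split=> -[cU locf]; split=> // x Ux.
  have [p [q [qx fE]]] := locf x Ux.
  exists (fun x => mpoly.meval (coord x) p), (fun x => mpoly.meval (coord x) q).
  by split=> //; [exists p|exists q].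
have [p [q [[p' pE] [q' qE] qx fE]]] := locf x Ux.
exists p', q'; rewrite -qE; split=> // y Uy; rewrite -qE -pE; exact: fE.
Qed.

Lemma zclosed_coordinate_zeros (F : set (T -> K)) :
  F `<=` polyfun -> zclosed X [set x | forall f, F f -> f x = 0].
Proof. by move=> FP; apply/zclosed_coordinateP; exists F. Qed.

Lemma zclosed_coordinate_zero f : polyfun f -> zclosed X [set x | f x = 0].
Proof.
move=> fP; apply: (eq_zclosed (@zclosed_coordinate_zeros [set f] _)).
  by move=> g ->.
by apply/seteqP; split=> x /= => [/(_ f erefl)//|fx _ ->].
Qed.

Lemma zclosed_coordinate0 : zclosed X set0.
Proof.
have [polyC _ _] := polyfun_algebra.
apply: (eq_zclosed (zclosed_coordinate_zero (polyC 1))).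
by apply/seteqP; split=> x //= /eqP; rewrite oner_eq0.
Qed.

Lemma zclosed_coordinateU Z1 Z2 :
  zclosed X Z1 -> zclosed X Z2 -> zclosed X (Z1 `|` Z2).
Proof.
have [_ _ polyM] := polyfun_algebra.
move=> /zclosed_coordinateP[F1 P1 ->] /zclosed_coordinateP[F2 P2 ->].
apply/zclosed_coordinateP.
exists [set h | exists f g, [/\ F1 f, F2 g & h = fun x => f x * g x]].
  by move=> _ [f [g [F1f F2g ->]]]; apply: polyM; [exact: P1|exact: P2].
apply/seteqP; split=> x /=.
  move=> Fx h [f [g [F1f F2g ->]]].
  case: Fx => Fx; first by rewrite (Fx f F1f) mul0r.
  by rewrite (Fx g F2g) mulr0.
move=> Fx; apply: contrapT => /not_orP[/existsNP[f /not_implyP[F1f fx]]].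
move=> /existsNP[g /not_implyP[F2g gx]].
have /eqP := Fx (fun x => f x * g x) (ex_intro _ f (ex_intro _ g
  (And3 F1f F2g erefl))).
by rewrite mulf_eq0 => /orP[] /eqP.
Qed.

Lemma zclosed_coordinate_bigcup (I : eqType) (r : seq I) (Z : I -> set T) :
  (forall i, zclosed X (Z i)) ->
  zclosed X [set x | exists2 i, i \in r & Z i x].
Proof.
move=> cZ; elim: r => [|i r IHr].
  apply: (eq_zclosed zclosed_coordinate0).
  by apply/seteqP; split=> x //= [].
apply: (eq_zclosed (zclosed_coordinateU (cZ i) IHr)).
apply/seteqP; split=> x /=.
  by move=> [Zx|[j rj Zx]]; [exists i|exists j]; rewrite // inE ?eqxx ?rj ?orbT.
by move=> [j + Zx]; rewrite inE => /orP[/eqP <-|rj]; [left|right; exists j].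
Qed.

End CoordinateSpaces.

(** * Morphisms of spaces with functions *)

Section Morphisms.
Variable K : fieldType.

Lemma zopen_setI_preimage T S (X : space_with_functions K T)
    (Y : space_with_functions K S) f V :
  is_morphism X Y f -> zopen Y V -> zopen X (points X `&` f @^-1` V).
Proof.
move=> [fX fc _] [VY cV]; split=> [x []//|].
rewrite (_ : _ `\` _ = points X `&` f @^-1` (points Y `\` V)); first exact: fc.
apply/seteqP; split=> x /=; first by move=> [Xx nV]; split=> //; split;
  [exact: fX|move=> Vx; exact: nV].
by move=> [Xx [_ nV]]; split=> // -[].
Qed.

Lemma is_morphism_comp T S W (X : space_with_functions K T)
    (Y : space_with_functions K S) (Z : space_with_functions K W) f g :
  is_morphism X Y f -> is_morphism Y Z g -> is_morphism X Z (g \o f).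
Proof.
move=> mf mg; have [fX fc fr] := mf; have [gY gc gr] := mg.
have preE V : points X `&` (g \o f) @^-1` V =
    points X `&` f @^-1` (points Y `&` g @^-1` V).
  apply/seteqP; split=> x [Xx] /=; last by case.
  by move=> Vx; split=> //; split=> //; exact: fX.
split=> [x /fX /gY//|Z' cZ'|V h oV rV]; first by rewrite preE; exact/fc/gc.
rewrite preE; apply: (fr _ (h \o g)); last exact: gr.
exact: zopen_setI_preimage oV.
Qed.

Lemma quotient_map_morphism T S (X : space_with_functions K T) (q : T -> S) :
  is_morphism X (quotient_space X q) q.
Proof. by split=> [x Xx|Z []//|V h _ []//]; exists x. Qed.

(** Regularity is local: a quotient valid only inside [W] becomes valid wherever its denominator is
    nonzero, once numerator and denominator are multiplied by a polynomial [s] that vanishes outside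
    [W]. *)
Lemma coordinate_space_sheaf d T (coord : T -> 'I_d -> K) U f :
  zopen (coordinate_space coord) U ->
  (forall x, U x -> exists W g, [/\ zopen (coordinate_space coord) W,
     regular (coordinate_space coord) W g, W x
     & forall y, U y -> W y -> f y = g y]) ->
  regular (coordinate_space coord) U f.
Proof.
have [_ _ polyM] := polyfun_algebra coord.
move=> [_]; rewrite setTD => cU locf; apply/regular_coordinateP.
split=> // x Ux; have [W [g [[_ + rg Wx fg]]]] := locf x Ux.
rewrite setTD => /zclosed_coordinateP[F FP WE].
have /existsNP[s /not_implyP[Fs /eqP sx]] : ~ (forall s, F s -> s x = 0).
  by move=> Fx; have : (~` W) x by rewrite WE.
have [_ /(_ x Wx)[p [q [pP qP qx gE]]]] := (regular_coordinateP _ _ _).1 rg.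
exists (fun y => p y * s y), (fun y => q y * s y); split.
- by apply: polyM => //; exact: FP.
- by apply: polyM => //; exact: FP.
- by rewrite mulf_neq0.
move=> y Uy; rewrite mulf_eq0 negb_or => /andP[qy sy].
have Wy : W y.
  apply: contrapT => nWy; have : (~` W) y by [].
  by rewrite WE => /(_ s Fs) /eqP; rewrite (negPf sy).
by rewrite fg// gE// -mulf_div divff// mulr1.
Qed.

(** A regular function on the subspace extends to the ambient space only locally, so its pullback
    has to be glued. *)
Lemma morphism_to_subspace d T S (coord : T -> 'I_d -> K)
    (Y : space_with_functions K S) (A : set S) f :
  is_morphism (coordinate_space coord) Y f -> (forall x, A (f x)) ->
  is_morphism (coordinate_space coord) (subspace Y A) f.
Proof.
move=> mf fA; have [fX fc fr] := mf.
have fc' Z : zclosed (subspace Y A) Z ->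
    zclosed (coordinate_space coord)
      (points (coordinate_space coord) `&` f @^-1` Z).
  move=> [Z' cZ' ->]; apply: (eq_zclosed (fc _ cZ')).
  by apply/seteqP; split=> x /= [_ Zx]; split=> //; case: Zx.
split=> // [x _|V h [VA cV] [_ _ lV]]; first by split=> //; exact: fX.
apply: coordinate_space_sheaf.
  split=> //; rewrite setTD; apply: (eq_zclosed (fc' _ cV)).
  apply/seteqP; split=> x /=; first by move=> [_ [_ nV]] [].
  by move=> nV; split=> //; split=> [|Vx];
    [split=> //; exact: fX|exact: nV].
move=> x [_ Vx]; have [W [g [oW rg Wx hg]]] := lV _ Vx.
exists (setT `&` f @^-1` W), (g \o f); split=> //=.
- exact: zopen_setI_preimage oW.
- exact: fr.
- by move=> y [_ Vy] [_ Wy]; exact: hg.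
Qed.

Lemma polynomial_morphism d e T S (cT : T -> 'I_d -> K) (cS : S -> 'I_e -> K)
    (f : T -> S) :
  (forall i, polyfun cT (fun x => cS (f x) i)) ->
  is_morphism (coordinate_space cT) (coordinate_space cS) f.
Proof.
move=> fP.
have polyf h : polyfun cS h -> polyfun cT (h \o f).
  move=> [p hE]; rewrite /comp; under eq_fun do rewrite hE.
  exact: (function_algebra_meval (v := fun x => cS (f x)) (polyfun_algebra cT)).
have fc Z : zclosed (coordinate_space cS) Z ->
    zclosed (coordinate_space cT) (f @^-1` Z).
  move=> /zclosed_coordinateP[F FP ->]; apply/zclosed_coordinateP.
  exists [set h \o f | h in F]; first by move=> _ [h /FP hP <-]; exact: polyf.
  apply/seteqP; split=> x /= Fx => [_ [h Fh <-]|h Fh]; first exact: Fx.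
  by apply: Fx (h \o f) _; exists h.
split=> // [Z cZ|V h [_ cV] /regular_coordinateP[cV' lV]].
  by rewrite setTI; exact: fc.
rewrite setTI; apply/regular_coordinateP; split; first exact: fc cV'.
move=> x /= /lV[p [q [pP qP qx hE]]].
exists (p \o f), (q \o f); split=> //; try exact: polyf.
by move=> y; exact: hE.
Qed.

Section RationalFunctions.
Variables (d : nat) (T : Type) (coord : T -> 'I_d -> K).
Variables (A : set T) (D : T -> K).

Definition ratfun : set (T -> K) := [set f | exists P k, polyfun coord P /\
  forall x, A x -> D x != 0 -> f x = P x / D x ^+ k].

Lemma ratfun_algebra : polyfun coord D -> function_algebra ratfun.
Proof.
have algP := polyfun_algebra coord; have [polyC polyD polyM] := algP.
move=> DP; have DXP k : polyfun coord (fun x => D x ^+ k).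
  exact: function_algebra_exp.
split=> [c|f g [P [k [PP fE]]] [Q [l [QP gE]]]|f g [P [k [PP fE]]] [Q [l [QP gE]]]].
- by exists (fun=> c), 0%N; split=> // x _ _; rewrite expr0 divr1.
- exists (fun x => P x * D x ^+ l + Q x * D x ^+ k), (k + l)%N; split.
    by apply: polyD; exact: polyM.
  by move=> x Ax Dx; rewrite fE// gE// addf_div ?expf_neq0// exprD.
- exists (fun x => P x * Q x), (k + l)%N; split; first exact: polyM.
  by move=> x Ax Dx; rewrite fE// gE// mulf_div exprD.
Qed.

Variables (S : Type) (q : T -> S) (B : set S) (e : nat) (F : S -> 'rV[K]_e).
Hypothesis DP : polyfun coord D.
Hypothesis FP : forall i, ratfun (fun x => F (q x) 0 i).
Hypothesis Dq : forall x y, A x -> A y -> q x = q y -> D x != 0 -> D y != 0.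
Hypothesis Bq : forall s, B s -> exists x, [/\ A x, q x = s & D x != 0].

Let X := subspace (coordinate_space coord) A.
Let Y := quotient_space X q.

Let ratF p : ratfun (fun x => mpoly.meval (fun i => F (q x) 0 i) p).
Proof.
exact: (function_algebra_meval (v := fun x i => F (q x) 0 i) (ratfun_algebra DP)).
Qed.

Let polyFun_comp p : polyfun (fun (y : 'rV[K]_e) i => y 0 i) p ->
  exists P k, polyfun coord P /\
    forall x, A x -> D x != 0 -> p (F (q x)) = P x / D x ^+ k.
Proof.
move=> [p' pE]; have [P [k [PP pq]]] := ratF p'.
by exists P, k; split=> // x Ax Dx; rewrite pE pq.
Qed.

Let polyM : forall f g, polyfun coord f -> polyfun coord g ->
  polyfun coord (fun x => f x * g x).
Proof. by case: (polyfun_algebra coord). Qed.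

(* The D-nonvanishing locus is saturated but need not be all of X, whence the
   closed sets downstairs are closed up with the locus D = 0. *)
Lemma zclosed_quotient_zeros (I : set ('rV[K]_e -> K)) :
  I `<=` polyfun (fun (y : 'rV[K]_e) i => y 0 i) ->
  zclosed Y [set s | (q @` A) s /\
    forall x, A x -> q x = s -> D x != 0 -> forall p, I p -> p (F s) = 0].
Proof.
move=> IP; split; first by move=> s [[x Ax <-] _]; exists x.
pose J := [set h | exists p P k, [/\ I p, polyfun coord P,
  forall x, A x -> D x != 0 -> p (F (q x)) = P x / D x ^+ k
  & h = fun x => D x * P x]].
exists [set x | forall h, J h -> h x = 0].
  by apply: zclosed_coordinate_zeros => _ [p [P [k [_ PP _ ->]]]]; exact: polyM.
apply/seteqP; split=> x /=.
  move=> [[_ Ax] [_ Zx]]; split=> // _ [p [P [k [Ip PP pE ->]]]].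
  have [->|Dx] := eqVneq (D x) 0; first by rewrite mul0r.
  have /eqP := Zx x Ax erefl Dx p Ip.
  rewrite pE// mulf_eq0 invr_eq0 (negPf (expf_neq0 k Dx)) orbF => /eqP ->.
  by rewrite mulr0.
move=> [Ax Jx]; split=> //; split; first by exists x.
move=> y Ay qy Dy p Ip; have Dx := Dq Ay Ax qy Dy.
have [P [k [PP pE]]] := polyFun_comp (IP p Ip).
have /eqP : D x * P x = 0.
  by apply: (Jx (fun x => D x * P x)); exists p, P, k.
by rewrite mulf_eq0 (negPf Dx) /= pE// => /eqP ->; rewrite mul0r.
Qed.

(** Closed sets and regular functions of a quotient are defined by pulling back, so everything is
    checked upstairs, where the components of [F] are fractions over powers of [D]. *)
Lemma rational_morphism : is_morphism (subspace Y B) (affine_space K e) F.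
Proof.
have ptsE s : points (subspace Y B) s <-> B s.
  split=> [[]//|Bs]; split=> //; have [x [Ax <- _]] := Bq Bs.
  by exists x.
have Fc Z : zclosed (affine_space K e) Z ->
    zclosed (subspace Y B) (points (subspace Y B) `&` F @^-1` Z).
  move=> /zclosed_coordinateP[I IP ->]; apply: (ex_intro2 _ _ _ (zclosed_quotient_zeros IP)).
  apply/seteqP; split=> s /=.
    move=> [[_ Bs] Is]; split=> //; split; last by move=> *; exact: Is.
    by have [x [Ax <- _]] := Bq Bs; exists x.
  move=> [Bs [_ Zs]]; split; first exact/ptsE.
  by have [x [Ax qx Dx]] := Bq Bs; exact: Zs Ax qx Dx.
split=> // V h [_ cV] /regular_coordinateP[_ lh]; split; first by move=> s [].
  apply: (eq_zclosed (Fc _ cV)); apply/seteqP.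
  split=> s /=; first by move=> [Ps [_ nV]]; split=> // -[].
  by move=> [Ps nV]; split=> //; split=> // Vs; exact: nV.
move=> s [Ps Vs]; have [p [r [pP rP rs hE]]] := lh _ Vs.
have Bs := (ptsE s).1 Ps.
(* The function is p / r near s, so r must not vanish on the image of [W]; the condition on [D]
   makes the complement of [W] a closed set of the form in [zclosed_quotient_zeros]. *)
pose W := [set s | exists x, [/\ A x, q x = s, D x != 0 & r (F s) != 0]].
have cW : zclosed Y (points Y `\` W).
  have Ir : [set r] `<=` polyfun (fun (y : 'rV[K]_e) i => y 0 i) by move=> _ ->.
  apply: (eq_zclosed (zclosed_quotient_zeros Ir)); apply/seteqP.
  split=> t /=.
    move=> [At Zt]; split; first by case: At => x Ax <-; exists x.
    by move=> [x [Ax qx Dx]]; rewrite (Zt x Ax qx Dx r erefl) eqxx.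
  move=> [[x [_ Ax] <-] nW]; split; first by exists x.
  move=> y Ay qy Dy _ ->; apply: contrapT => /eqP rx; apply: nW.
  by exists y.
have WY : W `<=` points Y by move=> _ [x [Ax <- _ _]]; exists x.
exists W, (fun s => p (F s) / r (F s)); split.
- by [].
- split=> //; split; first by move=> x [].
    have [_ [Z' cZ' ZE]] := cW; exists Z' => //; rewrite -ZE; apply/seteqP.
    split=> x /=.
      move=> [[_ Ax] nW]; split=> //; split; first by exists x.
      by move=> Wx; apply: nW.
    by move=> [[_ Ax] [_ nW]]; split=> // -[_].
  move=> x [[_ Ax] [y [Ay qy Dy ry]]].
  have Dx := Dq Ay Ax qy Dy.
  have [P [k [PP pE]]] := polyFun_comp pP.
  have [Q [l [QP rE]]] := polyFun_comp rP.
  have Qx : Q x != 0.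
    by apply: contra_neq ry => Qx; rewrite rE// Qx mul0r.
  have DXP j : polyfun coord (fun x => D x ^+ j).
    exact: (function_algebra_exp (polyfun_algebra coord) j DP).
  have cDQ : zclosed (coordinate_space coord) (~` [set x | D x * Q x != 0]).
    apply: (eq_zclosed (zclosed_coordinate_zero (polyM DP QP))).
    by apply/seteqP; split=> z /=; [move=> ->; rewrite eqxx
      |move=> /negP; rewrite negbK => /eqP].
  (* This is (P / D^k) / (Q / D^l) cleared of inner fractions. *)
  exists [set x | D x * Q x != 0],
    (fun x => P x * D x ^+ l / (Q x * D x ^+ k)); split.
  + by split=> //; rewrite setTD.
  + apply/regular_coordinateP; split=> // z; rewrite /= mulf_eq0 negb_or.
    move=> /andP[Dz Qz]; exists (fun x => P x * D x ^+ l), (fun x => Q x * D x ^+ k).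
    by split=> //; try exact: polyM; rewrite mulf_neq0 ?expf_neq0.
  + by rewrite /= mulf_neq0.
  + move=> z [[_ Az] _] /=; rewrite mulf_eq0 negb_or => /andP[Dz Qz].
    rewrite pE// rE//; move: (expf_neq0 k Dz) (expf_neq0 l Dz) => Dk Dl.
    by rewrite invf_div mulf_div; congr (_ / _); rewrite mulrC.
- by have [x [Ax qx Dx]] := Bq Bs; exists x.
- by move=> t [_ Vt] [x [_ _ _ rt]] /=; exact: hE.
Qed.

End RationalFunctions.

(** Cells are subspaces of the Hessenberg variety, whereas charts are built on the flag variety.
    Closed sets and local extensions carry over from the direct to the two-stage structure by
    cutting them down to [B]. *)
Lemma subspace_subspace_morphism T S (X : space_with_functions K T)
    (Y : space_with_functions K S) (A B : set T) f :
  A `<=` B -> is_morphism (subspace X A) Y f ->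
  is_morphism (subspace (subspace X B) A) Y f.
Proof.
move=> AB [fX fc fr].
have ptsE : points X `&` B `&` A = points X `&` A.
  by rewrite -setIA (setIidr AB).
have cl Z : zclosed (subspace X A) Z -> zclosed (subspace (subspace X B) A) Z.
  move=> [Z' cZ' ->]; exists (B `&` Z'); first by exists Z'.
  by rewrite setIA (setIidl AB).
split=> [x [[Xx _] Ax]|Z cZ|V h oV rV]; first exact: fX.
  by rewrite /= ptsE; exact/cl/fc.
rewrite /= ptsE.
have [UX cU lU] := fr V h oV rV.
split; [exact: UX|exact: cl|].
move=> x [[[Xx Bx] Ax] Vx].
have [W [g [[WX cW] rg Wx fg]]] := lU x (conj (conj Xx Ax) Vx).
have cW' : zclosed (subspace X B) ((points X `&` B) `\` (W `&` B)).
  exists (points X `\` W) => //; apply/seteqP; split=> y /=.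
    move=> [[Xy By] nW]; split=> //; split=> // Wy; exact: nW.
  by move=> [By [Xy nW]]; split=> // -[].
exists (W `&` B), g; split.
- by split=> // y [Wy By]; split=> //; exact: WX.
- split=> //; first by move=> y [Wy By]; split=> //; exact: WX.
  by move=> y [Wy By]; exists W, g.
- by [].
- by move=> y [[[Xy _] Ay] Vy] [Wy _]; exact: fg.
Qed.

End Morphisms.

(** * Triangular matrices and the Bruhat decomposition *)

Section TriangularMatrices.
Variables (K : fieldType) (n : nat).
Implicit Types (A B : 'M[K]_n) (r : rel 'I_n).

Lemma upper_mxP A : reflect (forall i j : 'I_n, (j < i)%N -> A i j = 0) (upper_mx A).
Proof.
apply: (iffP is_trig_mxP) => Aup i j ij; last by rewrite mxE Aup.
by have := Aup j i ij; rewrite mxE.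
Qed.

Lemma upper_mulmx A B : upper_mx A -> upper_mx B -> upper_mx (A *m B).
Proof.
move=> /upper_mxP Aup /upper_mxP Bup; apply/upper_mxP => i j ji.
rewrite mxE big1// => l _; have [li|il] := ltnP l i; first by rewrite Aup ?mul0r.
by rewrite Bup ?mulr0// (leq_trans ji).
Qed.

Lemma det_upper A : upper_mx A -> \det A = \prod_i A i i.
Proof. by move=> Aup; rewrite -det_tr det_trig//; apply: eq_bigr => i _; rewrite mxE. Qed.

Lemma upper_unitmx A : upper_mx A -> (A \in unitmx) = [forall i, A i i != 0].
Proof.
move=> Aup; rewrite unitmxE det_upper// unitfE.
by apply/prodf_neq0/forallP => + i => /(_ i); exact.
Qed.

Lemma upper_diag_neq0 A i : upper_mx A -> A \in unitmx -> A i i != 0.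
Proof. by move=> Aup; rewrite upper_unitmx// => /forallP. Qed.

Lemma upper_diag_mulmx A B i : upper_mx A -> upper_mx B ->
  (A *m B) i i = A i i * B i i.
Proof.
move=> /upper_mxP Aup /upper_mxP Bup; rewrite mxE (bigD1 i)//= big1 ?addr0// => l.
by rewrite neq_ltn => /orP[li|il]; [rewrite Aup ?mul0r|rewrite Bup ?mulr0].
Qed.

Lemma support_invmx r A : transitive r -> (forall i j, r i j -> (i < j)%N) ->
  A \in unitmx -> (forall i j, A i j != 0 -> (i == j) || r i j) ->
  forall i j, (invmx A) i j != 0 -> (i == j) || r i j.
Proof.
move=> rT rlt Au Ar; have Aup : upper_mx A.
  apply/upper_mxP => i j ji; apply/eqP/negPn/negP => /Ar /orP[/eqP ijE|/rlt].
    by rewrite ijE ltnn in ji.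
  by rewrite ltnNge ltnW.
suff: forall k (i j : 'I_n), (n - i <= k)%N -> invmx A i j != 0 -> (i == j) || r i j.
  by move=> H i j; exact: (H n i j (leq_subr _ _)).
elim=> [|k IHk] i j ik; first by have := ltn_ord i; lia.
have [//|ij /=] := eqVneq i j; apply: contraNT => rij; apply/eqP.
have: (A *m invmx A) i j = 0 by rewrite mulmxV// mxE (negPf ij).
rewrite mxE (bigD1 i)//= big1 ?addr0 => [/eqP|l li].
  by rewrite mulf_eq0 (negPf (upper_diag_neq0 _ Aup Au)) => /eqP.
have [->|/Ar] := eqVneq (A i l) 0; first by rewrite mul0r.
rewrite eq_sym (negPf li) /= => ril.
have lk : (n - l <= k)%N by have := rlt _ _ ril; lia.
have [->|/(IHk l j lk)] := eqVneq (invmx A l j) 0; first by rewrite mulr0.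
case/orP => [/eqP lj|rlj].
  by rewrite -lj ril in rij.
by rewrite (rT _ _ _ ril rlj) in rij.
Qed.

Lemma upper_invmx A : upper_mx A -> A \in unitmx -> upper_mx (invmx A).
Proof.
move=> Aup Au; apply/upper_mxP => i j ji; apply/eqP; apply: contraTT ji => Aij.
rewrite -leqNgt leq_eqVlt val_eqE.
apply: (support_invmx (r := fun a b => (a < b)%N) _ _ Au _ Aij) => // [a b c|a b Aab].
  exact: ltn_trans.
rewrite -val_eqE -leq_eqVlt leqNgt; apply: contra_neqN Aab => ba.
exact: (upper_mxP _ Aup).
Qed.

(* The matrices of the group 1 + span {E_ij | r i j}, r a strict order. *)
Definition unipotent_on r A : Prop :=
  (forall i, A i i = 1) /\ forall i j, i != j -> A i j != 0 -> r i j.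

Lemma unipotent_on_support r A i j :
  unipotent_on r A -> A i j != 0 -> (i == j) || r i j.
Proof. by move=> [_ Ar] Aij; have [//|ij] := eqVneq i j; exact: Ar. Qed.

Lemma unipotent_on_upper r A : (forall i j, r i j -> (i < j)%N) ->
  unipotent_on r A -> upper_mx A.
Proof.
move=> rlt [_ Ar]; apply/upper_mxP => i j ji; apply/eqP/negPn/negP => Aij.
have /rlt := Ar i j (negbT (gtn_eqF ji)) Aij; lia.
Qed.

Lemma det_unipotent_on r A : (forall i j, r i j -> (i < j)%N) ->
  unipotent_on r A -> \det A = 1.
Proof.
move=> rlt Ar; rewrite (det_upper (unipotent_on_upper rlt Ar)).
by rewrite big1// => i _; case: Ar.
Qed.

Lemma unitmx_unipotent_on r A : (forall i j, r i j -> (i < j)%N) ->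
  unipotent_on r A -> A \in unitmx.
Proof.
by move=> rlt Ar; rewrite unitmxE (det_unipotent_on rlt Ar) unitr1.
Qed.

Lemma invmx_unipotent_on r A : transitive r -> (forall i j, r i j -> (i < j)%N) ->
  unipotent_on r A -> unipotent_on r (invmx A).
Proof.
move=> rT rlt Ar; have Au := unitmx_unipotent_on rlt Ar.
have Aup := unipotent_on_upper rlt Ar.
split=> [i|i j ij /(support_invmx rT rlt Au _)].
  have := upper_diag_mulmx i Aup (upper_invmx Aup Au).
  by rewrite mulmxV// mxE eqxx; case: Ar => -> _; rewrite mul1r.
rewrite (negPf ij); apply=> a b; exact: unipotent_on_support.
Qed.

End TriangularMatrices.

(** * Elimination to a permutation matrix, and ranks of lower left corners *)

Section Bruhat.
Variables (K : fieldType) (n : nat).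
Implicit Types (A B C : 'M[K]_n) (w : 'S_n).

Lemma upper_diag_mx (t : 'rV[K]_n) : upper_mx (diag_mx t).
Proof. by rewrite /upper_mx tr_diag_mx diag_mx_is_trig. Qed.

Lemma perm_mxVE w i j : perm_mx w^-1 i j = (i == w j)%:R :> K.
Proof. by rewrite !mxE (canF_eq (permKV w)). Qed.

Lemma col_neq0_unitmx A j : A \in unitmx -> exists i, A i j != 0.
Proof.
move=> Au; apply/existsP; apply: contraT; rewrite negb_exists => /forallP A0.
have /(congr1 (mulmx (invmx A))) : A *m (delta_mx j 0 : 'cV_n) = 0.
  rewrite -colE; apply/matrixP => i k; rewrite !mxE; apply/eqP.
  by have := A0 i; rewrite negbK.
rewrite mulKmx// mulmx0 => /matrixP/(_ j 0); rewrite !mxE !eqxx => /eqP.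
by rewrite oner_eq0.
Qed.

(** Elimination column by column. The pivot is the lowest nonzero entry of its column, so row
    operations only move multiples upwards, column operations only to the right, and both are upper
    triangular. The map [p] is meaningful on the first k columns only. *)
Lemma bruhat_step A (k : nat) : A \in unitmx -> (k <= n)%N ->
  exists L R (p : 'I_n -> 'I_n),
  [/\ upper_mx L, L \in unitmx, upper_mx R & R \in unitmx] /\
  forall j : 'I_n, (j < k)%N -> forall i,
    (L *m A *m R) i j = (i == p j)%:R /\ (L *m A *m R) (p j) i = (i == j)%:R.
Proof.
move=> Au; elim: k => [|k IHk] kn.
  exists 1%:M, 1%:M, id; rewrite unitmx1; split=> //; split=> //;
  by rewrite -diag_const_mx upper_diag_mx.
have [L [R [p [[Lup Lu Rup Ru] Cp]]]] := IHk (ltnW kn).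
have [C CE] : {C | L *m A *m R = C} by exists (L *m A *m R).
rewrite CE in Cp; have Cu : C \in unitmx by rewrite -CE !unitmx_mul Lu Au.
pose c := Ordinal kn; have [i0 Ci0] := col_neq0_unitmx c Cu.
pose i := [arg max_(i > i0 | C i c != 0) i : nat].
have [Ci Cmax] : C i c != 0 /\ forall a, C a c != 0 -> (a <= i)%N.
  by rewrite /i; case: arg_maxnP.
have Cc (j : 'I_n) : (j < k)%N -> C (p j) c = 0.
  move=> jk; have [_ ->] := Cp j jk c; rewrite -val_eqE /=.
  by rewrite gtn_eqF.
have pi (j : 'I_n) : (j < k)%N -> (i == p j) = false.
  by move=> jk; apply: contraNF Ci => /eqP ->; rewrite Cc.
have Cij (j : 'I_n) : (j < k)%N -> C i j = 0 by move=> jk; have [-> _] := Cp j jk i; rewrite pi.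
(* [L'] scales row i to make the pivot 1 and clears the rest of column c; [R'] clears the rest of
   row i by subtracting multiples of column c. *)
pose L' := 1%:M + \matrix_(a, b) (((a == i)%:R - C a c) / C i c * (b == i)%:R) : 'M_n.
pose R' := 1%:M + \matrix_(a, b) ((a == c)%:R * ((b == c)%:R - C i b / C i c)) : 'M_n.
have L'up : upper_mx L'.
  apply/upper_mxP => a b ba; rewrite !mxE.
  rewrite -[a == b]val_eqE (gtn_eqF ba) add0r.
  have [bi|] := eqVneq b i; last by rewrite mulr0.
  rewrite bi in ba; rewrite -[a == i]val_eqE (gtn_eqF ba).
  suff -> : C a c = 0 by rewrite subrr !mul0r.
  by apply/eqP; apply: contraTT ba => /Cmax; rewrite -leqNgt.
have R'up : upper_mx R'.
  apply/upper_mxP => a b ba; rewrite !mxE -[a == b]val_eqE (gtn_eqF ba) add0r.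
  have [ac|] := eqVneq a c; last by rewrite mul0r.
  rewrite ac in ba; rewrite -[b == c]val_eqE (ltn_eqF ba) Cij//.
  by rewrite mul0r subrr mulr0.
exists (L' *m L), (R *m R'), (fun j => if j == c then i else p j); split.
  split; [exact: upper_mulmx| |exact: upper_mulmx|].
    rewrite unitmx_mul Lu andbT upper_unitmx//; apply/forallP => a.
    rewrite !mxE eqxx; have [->|_] := eqVneq a i; last by rewrite mulr0 addr0 oner_eq0.
    by rewrite mulr1 mulrBl divff// mul1r addrC subrK invr_eq0.
  rewrite unitmx_mul Ru upper_unitmx//; apply/forallP => a.
  rewrite !mxE eqxx; have [->|_] := eqVneq a c; last by rewrite mul0r addr0 oner_eq0.
  by rewrite divff// subrr mulr0 addr0 oner_eq0.
have L'E B a b : (L' *m B) a b = B a b + ((a == i)%:R - C a c) / C i c * B i b.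
  rewrite mulmxDl mul1mx mxE; congr (_ + _); rewrite mxE (bigD1 i)//= big1 => [|l /negPf li].
    by rewrite mxE eqxx mulr1 addr0.
  by rewrite mxE li mulr0 mul0r.
have R'E B a b : (B *m R') a b = B a b + B a c * ((b == c)%:R - C i b / C i c).
  rewrite mulmxDr mulmx1 mxE; congr (_ + _); rewrite mxE (bigD1 c)//= big1 => [|l /negPf lc].
    by rewrite mxE eqxx mul1r addr0.
  by rewrite mxE lc mul0r mulr0.
have EE a b : (L' *m L *m A *m (R *m R')) a b =
    C a b - C a c * C i b / C i c + (a == i)%:R * (b == c)%:R.
  by rewrite -!mulmxA (mulmxA L) (mulmxA _ R) CE mulmxA R'E !L'E; field.
move=> j; rewrite ltnS => jk a; rewrite !EE.
have [->|jc] := eqVneq j c.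
  split; first by rewrite mulfK// subrr add0r mulr1.
  by rewrite mulrAC divff// mul1r subrr add0r eqxx mul1r.
have {}jk : (j < k)%N by move: jk jc; rewrite leq_eqVlt -val_eqE /= => /orP[->|].
have [Caj Cpa] := Cp j jk a; split.
  by rewrite Cij// mulr0 mul0r subr0 mulr0 addr0.
by rewrite Cc// !mul0r subr0 eq_sym pi// mul0r addr0.
Qed.

Lemma bruhat A : A \in unitmx -> exists w B1 B2,
  [/\ upper_mx B1, B1 \in unitmx, upper_mx B2, B2 \in unitmx
    & A = B1 *m perm_mx w^-1 *m B2].
Proof.
move=> Au; have [L [R [p [[Lup Lu Rup Ru] Cp]]]] := bruhat_step Au (leqnn n).
have p_inj : injective p.
  move=> i j pij; have [_ +] := Cp i (ltn_ord i) j; have [-> _] := Cp j (ltn_ord j) (p i).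
  by rewrite pij eqxx => /eqP; have [->//|_] := eqVneq j i; rewrite oner_eq0.
exists (perm p_inj), (invmx L), (invmx R); split; rewrite ?unitmx_inv//;
  try exact: upper_invmx.
suff <- : L *m A *m R = perm_mx (perm p_inj)^-1.
  by rewrite !mulmxA mulVmx// mul1mx -mulmxA mulmxV// mulmx1.
apply/matrixP => i j; rewrite perm_mxVE permE.
by have [] := Cp j (ltn_ord j) i.
Qed.

(** Multiplying by masks selects a corner without leaving the n x n matrices, so no dimension
    depends on p or q. *)
Definition mask (b : pred 'I_n) : 'M[K]_n := diag_mx (\row_i (b i)%:R).

Lemma maskE b i j : mask b i j = ((i == j) && b i)%:R.
Proof. by rewrite !mxE; have [->|] := eqVneq i j; rewrite ?mulr1n ?mulr0n. Qed.

Lemma mul_maskl b A i j : (mask b *m A) i j = (b i)%:R * A i j.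
Proof. by rewrite mul_diag_mx !mxE. Qed.

Lemma mul_maskr b A i j : (A *m mask b) i j = A i j * (b j)%:R.
Proof. by rewrite mul_mx_diag !mxE. Qed.

(** Subadditivity of the rank bounds the masks of b and of its complement from above; since they add
    up to the identity, both bounds are sharp. *)
Lemma rank_mask b : \rank (mask b) = #|b|.
Proof.
have mask_le (c : pred 'I_n) : (\rank (mask c) <= #|c|)%N.
  have -> : mask c = \sum_(i | c i) delta_mx i i.
    apply/matrixP => a j; rewrite maskE summxE.
    have [aj|aj] /= := eqVneq a j.
      have [ca|nca] := boolP (c a).
        rewrite (bigD1 a)//= big1 ?addr0 => [|i /andP[_ /negPf ia]].
          by rewrite mxE aj !eqxx.
        by rewrite mxE eq_sym ia.
      rewrite big1// => i ci; rewrite mxE; case: eqP => //= ai.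
      by rewrite ai ci in nca.
    rewrite big1// => i _; rewrite mxE; case: eqP => //= ai.
    by rewrite -ai eq_sym (negPf aj).
  rewrite -sum1_card; apply: (big_ind2 (fun A k => \rank A <= k)%N) => [|A a B b' Aa Bb|i _].
  - by rewrite mxrank0.
  - by apply: leq_trans (mxrank_add _ _) _; exact: leq_add.
  - by rewrite mxrank_delta.
apply/eqP; rewrite eqn_leq mask_le /=.
have: (n <= \rank (mask b) + \rank (mask (predC b)))%N.
  rewrite -[X in (X <= _)%N](mxrank1 K n); apply: leq_trans (mxrank_add _ _).
  suff -> : 1%:M = mask b + mask (predC b) by [].
  apply/matrixP => i j; rewrite [RHS]mxE !maskE mxE /=.
  by case: (i == j); case: (b i); rewrite ?addr0 ?add0r.
have bC : (#|b| + #|predC b| = n)%N by rewrite -[RHS]card_ord -(cardC b).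
move=> nle; rewrite -(leq_add2r #|predC b|) bC; apply: leq_trans nle _.
by rewrite leq_add2l.
Qed.

(** The rank of the lower left corner (rows from p on, columns before q), not a corank in the usual
    sense. *)
Definition corank (p q : nat) A : nat :=
  \rank (mask (fun i => p <= i)%N *m A *m mask (fun j => j < q)%N).

(** The rows from p on of B1 A involve only the rows from p on of A, and dually for the first q
    columns, so the masks can be inserted next to A. *)
Lemma corank_le p q B1 A B2 : upper_mx B1 -> upper_mx B2 ->
  (corank p q (B1 *m A *m B2) <= corank p q A)%N.
Proof.
move=> /upper_mxP B1up /upper_mxP B2up; rewrite /corank.
set M := mask _; set M' := mask _.
have -> : M *m (B1 *m A *m B2) *m M' = M *m B1 *m (M *m A *m M') *m (B2 *m M').
  have MB : M *m B1 *m M = M *m B1.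
    apply/matrixP => i j; rewrite mul_maskr mul_maskl.
    have [pj|jp] := leqP p j; first by rewrite mulr1.
    have [pi|ip] := leqP p i; last by rewrite !mul0r.
    by rewrite B1up ?mulr0 ?mul0r// (leq_trans jp).
  have BM : M' *m (B2 *m M') = B2 *m M'.
    apply/matrixP => i j; rewrite mul_maskl mul_maskr.
    have [iq|qi] := ltnP i q; first by rewrite mul1r.
    have [jq|qj] := ltnP j q; last by rewrite !mulr0.
    by rewrite B2up ?mul0r ?mulr0// (leq_trans jq).
  by rewrite !mulmxA MB -!mulmxA BM.
exact: leq_trans (mxrankM_maxl _ _) (mxrankM_maxr _ _).
Qed.

Lemma corank_borel p q B1 A B2 : upper_mx B1 -> B1 \in unitmx ->
  upper_mx B2 -> B2 \in unitmx -> corank p q (B1 *m A *m B2) = corank p q A.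
Proof.
move=> B1up B1u B2up B2u; apply/eqP; rewrite eqn_leq corank_le//=.
have {1}-> : A = invmx B1 *m (B1 *m A *m B2) *m invmx B2.
  by rewrite !mulmxA mulVmx// mul1mx -mulmxA mulmxV// mulmx1.
by apply: corank_le; exact: upper_invmx.
Qed.

Lemma corank_perm p q w :
  corank p q (perm_mx w^-1) = #|[pred j : 'I_n | (p <= w j)%N && (j < q)%N]|.
Proof.
rewrite /corank -rank_mask; set M := mask _; set M' := mask _.
have -> : M *m perm_mx w^-1 *m M' = perm_mx w^-1 *m mask [pred j : 'I_n | (p <= w j)%N && (j < q)%N].
  apply/matrixP => i j; rewrite !mul_maskr mul_maskl perm_mxVE /=.
  have [->|] := eqVneq i (w j); last by rewrite mulr0 !mul0r.
  by rewrite mulr1 mul1r -natrM mulnb.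
by rewrite eqmxMfull// row_full_unit unitmx_perm.
Qed.

(** Enlarging q from j to j + 1 raises the corner rank exactly when p <= w j, so the ranks determine
    w j; for this q must run up to n. *)
Lemma corank_perm_inj v w :
  (forall p q : 'I_n.+1, corank p q (perm_mx v^-1) = corank p q (perm_mx w^-1)) ->
  v = w.
Proof.
move=> vw; have countS (u : 'S_n) p (j : 'I_n) :
    #|[pred x : 'I_n | (p <= u x)%N && (x < j.+1)%N]| =
    ((p <= u j)%N + #|[pred x : 'I_n | (p <= u x)%N && (x < j)%N]|)%N.
  rewrite -!sum1_card !(big_mkcond (fun x => x \in _)) /=.
  rewrite (bigD1 j)//= [in RHS](bigD1 j)//= !inE /= ltnn andbF add0n ltnSn andbT.
  congr addn.
  apply: eq_bigr => x xj; rewrite !inE ltnS (leq_eqVlt x j).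
  by have -> : (x == j :> nat) = false by exact: negbTE xj.
have le_vw (p : 'I_n.+1) j : (p <= v j)%N = (p <= w j)%N.
  have := vw p (lift ord0 j); have := vw p (widen_ord (leqnSn n) j).
  rewrite !corank_perm /= => vwj; rewrite !countS vwj => /eqP.
  by rewrite eqn_add2r; case: (p <= v j)%N; case: (p <= w j)%N.
apply/permP => j; apply/val_inj/eqP; rewrite eqn_leq.
rewrite (le_vw (widen_ord (leqnSn n) (w j))) leqnn andbT.
by rewrite -(le_vw (widen_ord (leqnSn n) (v j))) leqnn.
Qed.

Definition corank_sum w : nat :=
  (\sum_(pq : 'I_n.+1 * 'I_n.+1) corank pq.1 pq.2 (perm_mx w^-1))%N.

(** Termwise inequalities against the order of the sums force equalities; thus the sum is strictly
    increasing for the rank order. *)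
Lemma corank_sum_inj v w :
  (forall p q : 'I_n.+1, corank p q (perm_mx v^-1) <= corank p q (perm_mx w^-1))%N ->
  (corank_sum w <= corank_sum v)%N -> v = w.
Proof.
move=> vw sum_wv; apply: corank_perm_inj => p q.
have [le eqc] := leqif_sum (fun (pq : 'I_n.+1 * 'I_n.+1) (_ : true) =>
  leqif_eq (vw pq.1 pq.2)).
have : corank_sum v == corank_sum w by rewrite eqn_leq sum_wv andbT; exact: le.
by rewrite eqc => /forallP/(_ (p, q))/eqP.
Qed.

End Bruhat.

(** * Rank bounds are closed conditions *)

Section RankClosed.
Variables (K : fieldType).

Lemma mxsub_unitmx_rank m n (A : 'M[K]_(m, n)) :
  exists f g, mxsub f g A \in @unitmx K (\rank A).
Proof.
pose B := rowsub (maxrankfun A) A.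
have Bf : row_full B^T.
  by rewrite /row_full mxrank_tr; exact: maxrowsub_free.
exists (maxrankfun A), (fullrankfun Bf).
rewrite -unitmx_tr -row_full_unit /row_full.
rewrite -[X in _ == X](mxrank_fullrowsub Bf); apply/eqP; congr (\rank _).
by apply/matrixP => i j; rewrite !mxE.
Qed.

Lemma rank_mxsub m n p q (f : 'I_p -> 'I_m) (g : 'I_q -> 'I_n) (A : 'M[K]_(m, n)) :
  (\rank (mxsub f g A) <= \rank A)%N.
Proof.
have -> : mxsub f g A = (rowsub g (rowsub f A)^T)^T.
  by apply/matrixP => i j; rewrite !mxE.
rewrite mxrank_tr; apply: leq_trans (mxrankS (rowsub_sub _ _)) _.
by rewrite mxrank_tr mxrankS// rowsub_sub.
Qed.

(** The equations are the minors of size above r. Their index maps may repeat rows or columns, which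
    only adds zero minors. *)
Lemma zclosed_rank_le d T (coord : T -> 'I_d -> K) m n (M : T -> 'M[K]_(m, n)) r :
  (forall i j, polyfun coord (fun x => M x i j)) ->
  zclosed (coordinate_space coord) [set x | (\rank (M x) <= r)%N].
Proof.
move=> MP.
pose F := [set h : T -> K | exists s (f : 'I_s -> 'I_m) (g : 'I_s -> 'I_n),
  (r < s)%N /\ h = fun x => \det (mxsub f g (M x))].
have FP : F `<=` polyfun coord.
  move=> _ [s [f [g [_ ->]]]]; apply: (function_algebra_det (polyfun_algebra coord)).
  by move=> i j; under eq_fun do rewrite mxE; exact: MP.
apply: (eq_zclosed (zclosed_coordinate_zeros FP)); apply/seteqP; split=> x /=.
  move=> Fx; rewrite leqNgt; apply/negP => rM.
  have [f [g]] := mxsub_unitmx_rank (M x); rewrite unitmxE unitfE => /eqP; apply.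
  by apply: (Fx (fun x => \det (mxsub f g (M x)))); exists _, f, g.
move=> Mr _ [s [f [g [rs ->]]]]; apply/eqP; rewrite -[_ == 0]negbK -unitfE.
rewrite -unitmxE -row_full_unit /row_full.
by have := leq_trans (rank_mxsub f g (M x)) Mr; lia.
Qed.

End RankClosed.

(** * Flag varieties and Schubert cells *)

Section CoordinateSpaceIntersection.
Variables (K : fieldType) (d : nat) (T : Type) (coord : T -> 'I_d -> K).

Lemma zclosed_coordinate_bigcap I (Z : I -> set T) :
  (forall i, zclosed (coordinate_space coord) (Z i)) ->
  zclosed (coordinate_space coord) [set x | forall i, Z i x].
Proof.
(* Taking all polynomials that vanish on the intersection avoids choosing equations for each
   [Z i]. *)
move=> cZ; pose F := [set h | polyfun coord h /\
  forall x, (forall i, Z i x) -> h x = 0].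
have FP : F `<=` polyfun coord by move=> h [].
apply: (eq_zclosed (zclosed_coordinate_zeros FP)); apply/seteqP; split=> x /=.
  move=> Fx i; have /zclosed_coordinateP[Fi FiP ZE] := cZ i.
  rewrite ZE => f Fif; apply: Fx; split; first exact: FiP.
  by move=> y /(_ i); rewrite ZE; exact.
by move=> Zx h [_]; exact.
Qed.

End CoordinateSpaceIntersection.

Section PermutationMatrices.
Variables (K : fieldType) (n : nat).
Implicit Types (A : 'M[K]_n) (w : 'S_n).

Lemma perm_conjE w A i j : (perm_mx w *m A *m perm_mx w^-1) i j = A (w i) (w j).
Proof. by rewrite -mulmxA -row_permE -col_permE 2!mxE. Qed.

Lemma invmx_perm_mxV w : invmx (perm_mx w^-1) = perm_mx w :> 'M[K]_n.
Proof.
have pu : perm_mx w^-1 \in @unitmx K n by exact: unitmx_perm.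
by rewrite -[RHS](mulKmx pu) -perm_mxM mulVg perm_mx1 mulmx1.
Qed.

End PermutationMatrices.

Section Coordinates.
Variables (K : fieldType) (n : nat).
Implicit Types (A B Q : 'M[K]_n).

Lemma invmx_mulmx A B : A \in unitmx -> B \in unitmx ->
  invmx (A *m B) = invmx B *m invmx A.
Proof.
move=> Au Bu; have ABu : A *m B \in unitmx by rewrite unitmx_mul Au.
by rewrite -[RHS](mulKmx ABu) -(mulmxA A) mulKVmx// mulmxV// mulmx1.
Qed.

Lemma coords_Ad Q A : Q \in unitmx -> coords Q (Ad Q A) = A.
Proof. by move=> Qu; rewrite /coords /Ad !mulmxA mulVmx// mul1mx mulmxKV. Qed.

Lemma Ad_coords Q A : Q \in unitmx -> Ad Q (coords Q A) = A.
Proof. by move=> Qu; rewrite /coords /Ad !mulmxA mulmxV// mul1mx mulmxK. Qed.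

Lemma coords_mul Q A B : Q \in unitmx ->
  coords Q (A *m B) = coords Q A *m coords Q B.
Proof. by move=> Qu; rewrite /coords !mulmxA mulmxK. Qed.

Lemma Ad_mul Q A B : Q \in unitmx -> Ad Q (A *m B) = Ad Q A *m Ad Q B.
Proof. by move=> Qu; rewrite /Ad !mulmxA mulmxKV. Qed.

Lemma coords1 Q : Q \in unitmx -> coords Q 1%:M = 1%:M.
Proof. by move=> Qu; rewrite /coords mulmx1 mulVmx. Qed.

Lemma det_coords Q A : Q \in unitmx -> \det (coords Q A) = \det A.
Proof.
move=> Qu; rewrite /coords !det_mulmx mulrAC -det_mulmx mulVmx// det1.
exact: mul1r.
Qed.

Lemma det_Ad Q A : Q \in unitmx -> \det (Ad Q A) = \det A.
Proof. by move=> Qu; rewrite -(det_coords _ Qu) coords_Ad. Qed.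

Lemma unitmx_coords Q A : Q \in unitmx -> (coords Q A \in unitmx) = (A \in unitmx).
Proof. by move=> Qu; rewrite !unitmxE det_coords. Qed.

Lemma unitmx_Ad Q A : Q \in unitmx -> (Ad Q A \in unitmx) = (A \in unitmx).
Proof. by move=> Qu; rewrite !unitmxE det_Ad. Qed.

Lemma coords_invmx Q A : Q \in unitmx -> A \in unitmx ->
  coords Q (invmx A) = invmx (coords Q A).
Proof.
move=> Qu Au; have cAu : coords Q A \in unitmx by rewrite unitmx_coords.
by rewrite -[LHS](mulKmx cAu) -coords_mul// mulmxV// coords1// mulmx1.
Qed.

Lemma coords_Ad_mul Q g A : Q \in unitmx -> g \in unitmx ->
  coords Q (Ad g A) = coords Q g *m coords Q A *m invmx (coords Q g).
Proof. by move=> Qu gu; rewrite /Ad 2?coords_mul// coords_invmx. Qed.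

Lemma coords_weyl_mx Q w : Q \in unitmx ->
  coords Q (weyl_mx Q w) = perm_mx w^-1.
Proof. by move=> Qu; exact: coords_Ad. Qed.

End Coordinates.

Section FlagVariety.
Variables (K : fieldType) (n : nat) (k : linear_group) (Q : 'M[K]_n).
Hypothesis Qu : Q \in unitmx.
Implicit Types (g b u Y : 'M[K]_n) (w : 'S_n).

Lemma group_set_unitmx g : group_set k g -> g \in unitmx.
Proof. by case: k => //= detg; rewrite unitmxE detg unitr1. Qed.

Lemma group_setM g h : group_set k g -> group_set k h -> group_set k (g *m h).
Proof.
case: k => /= [gu hu|dg dh]; first by rewrite unitmx_mul gu hu.
by rewrite det_mulmx dg dh mulr1.
Qed.

Lemma group_setV g : group_set k g -> group_set k (invmx g).
Proof.
by case: k => /= [gu|dg]; [rewrite unitmx_inv|rewrite det_inv dg invr1].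
Qed.

Lemma group_set_coords g : group_set k (coords Q g) = group_set k g.
Proof. by rewrite /group_set; case: k; rewrite /= ?unitmx_coords ?det_coords. Qed.

Lemma det1_group_set g : \det g = 1 -> group_set k g.
Proof. by case: k => //= dg; rewrite unitmxE dg unitr1. Qed.

Lemma borel1 : borel k Q 1%:M.
Proof.
split; first by apply: det1_group_set; rewrite det1.
by rewrite coords1// -diag_const_mx upper_diag_mx.
Qed.

Lemma borelM b c : borel k Q b -> borel k Q c -> borel k Q (b *m c).
Proof.
move=> [Gb bup] [Gc cup]; split; first exact: group_setM.
by rewrite coords_mul//; exact: upper_mulmx.
Qed.

Lemma borelV b : borel k Q b -> borel k Q (invmx b).
Proof.
move=> [Gb bup]; have bu := group_set_unitmx Gb; split; first exact: group_setV.
by rewrite coords_invmx//; apply: upper_invmx => //; rewrite unitmx_coords.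
Qed.

Lemma mem_coset g : coset k Q g g.
Proof. by exists 1%:M; [exact: borel1|rewrite mulmx1]. Qed.

Lemma coset_mul_borel g b : borel k Q b -> coset k Q (g *m b) = coset k Q g.
Proof.
move=> Bb; have bu := group_set_unitmx Bb.1.
apply/seteqP; split=> [_ [c Bc <-]|_ [c Bc <-]].
  by exists (b *m c); rewrite ?mulmxA//; exact: borelM.
exists (invmx b *m c); first by apply: borelM => //; exact: borelV.
by rewrite mulmxA mulmxK.
Qed.

Lemma eq_coset g h : coset k Q g = coset k Q h -> exists2 b, borel k Q b & h = g *m b.
Proof. by move=> gh; have := mem_coset h; rewrite -gh => -[b Bb <-]; exists b. Qed.

Lemma eq_coset_coords g h B : g \in unitmx -> group_set k g -> group_set k h ->
  upper_mx B -> coords Q h = coords Q g *m B -> coset k Q h = coset k Q g.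
Proof.
move=> gu Gg Gh Bup hE.
have hE' : h = g *m Ad Q B.
  by rewrite -(Ad_coords h Qu) hE Ad_mul// Ad_coords.
rewrite hE'; apply: coset_mul_borel; split; last by rewrite coords_Ad.
have -> : Ad Q B = invmx g *m h by rewrite hE' mulKmx.
by apply: group_setM => //; exact: group_setV.
Qed.

End FlagVariety.

Section DiagonalDeterminant.
Variables (K : fieldType).

(** Lets a torus element correct a factor to determinant 1, as SL_n demands. The correction sits in
    entry 0, hence the separate case of size 0. *)
Lemma exists_diag_det n (A : 'M[K]_n) : A \in unitmx ->
  exists2 t : 'rV[K]_n, (forall i, t 0 i != 0) & \det A * \det (diag_mx t) = 1.
Proof.
case: n A => [|n] A; first by exists 0; [case|rewrite !det_mx00 mulr1].
rewrite unitmxE unitfE => dA; exists (\row_i if i == 0 then (\det A)^-1 else 1).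
  move=> i; rewrite mxE; have [_|_] := eqVneq i 0; first by rewrite invr_eq0.
  exact: oner_neq0.
rewrite det_diag (bigD1 0)//= mxE eqxx big1 ?mulr1 ?divff// => i /negPf i0.
by rewrite mxE i0.
Qed.

Lemma unitmx_diag n (t : 'rV[K]_n) : (diag_mx t \in unitmx) = [forall i, t 0 i != 0].
Proof.
rewrite upper_unitmx ?upper_diag_mx//; apply: eq_forallb => i.
by rewrite mxE eqxx mulr1n.
Qed.

End DiagonalDeterminant.

Section SchubertCells.
Variables (K : fieldType) (n : nat) (k : linear_group) (Q : 'M[K]_n).
Hypothesis Qu : Q \in unitmx.
Implicit Types (g b u Y : 'M[K]_n) (w : 'S_n).

(** Frees the factors from the determinant condition: only the product has to lie in the group,
    because torus elements can be moved between the factors. *)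
Lemma schubert_cell_coordsP w x : schubert_cell k Q w x <->
  exists g B1 B2, [/\ group_set k g, x = coset k Q g,
    upper_mx B1 /\ B1 \in unitmx, upper_mx B2 /\ B2 \in unitmx
    & coords Q g = B1 *m perm_mx w^-1 *m B2].
Proof.
split=> [[b1 [g [b2 [[Gb1 b1up] [Gg [t gE]] [Gb2 b2up] ->]]]]|].
  exists (b1 *m g *m b2), (coords Q b1), (diag_mx t *m coords Q b2).
  have b1u := group_set_unitmx Gb1; have b2u := group_set_unitmx Gb2.
  have tu : diag_mx t \in unitmx.
    have := group_set_unitmx Gg; rewrite gE unitmx_mul => /andP[_].
    by rewrite unitmx_Ad.
  split=> //.
  - by apply: group_setM => //; exact: group_setM.
  - by rewrite unitmx_coords.
  - rewrite unitmx_mul tu unitmx_coords//; split=> //.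
    by apply: upper_mulmx => //; exact: upper_diag_mx.
  by rewrite !coords_mul// gE coords_mul// coords_weyl_mx// coords_Ad// !mulmxA.
move=> [g [B1 [B2 [Gg -> [B1up B1u] [B2up B2u] gE]]]].
have [t1 t1n dt1] := exists_diag_det B1u; have [t2 t2n dt2] := exists_diag_det B2u.
(* Cancels [t1], moved past the permutation, and [t2], so that the product is unchanged. *)
pose s := \row_j ((t1 0 (w j))^-1 * (t2 0 j)^-1).
pose b1 := Ad Q (B1 *m diag_mx t1); pose b2 := Ad Q (diag_mx t2 *m B2).
pose m := weyl_mx Q w *m Ad Q (diag_mx s).
have gm : g = b1 *m m *m b2.
  rewrite -[g](Ad_coords _ Qu) gE /m /weyl_mx -/(Ad Q _) -!Ad_mul//.
  rewrite !mulmxA; congr (Ad Q (_ *m B2)); rewrite -!mulmxA; congr (B1 *m _).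
  apply/matrixP => i j; rewrite !mulmxA !mul_mx_diag mul_diag_mx !mxE.
  rewrite (canF_eq (permKV w)); have [->|_] := eqVneq i (w j).
    by rewrite mulr1 mulrA divff// mul1r mulVf.
  by rewrite mulr0 !mul0r.
have Gb1 : group_set k b1.
  by apply: det1_group_set; rewrite det_Ad// det_mulmx.
have Gb2 : group_set k b2.
  by apply: det1_group_set; rewrite det_Ad// det_mulmx mulrC.
have b1u := group_set_unitmx Gb1; have b2u := group_set_unitmx Gb2.
have b1up : upper_mx (coords Q b1).
  by rewrite coords_Ad//; apply: upper_mulmx => //; exact: upper_diag_mx.
have b2up : upper_mx (coords Q b2).
  by rewrite coords_Ad//; apply: upper_mulmx => //; exact: upper_diag_mx.
have mE : exists t, m = weyl_mx Q w *m Ad Q (diag_mx t) by exists s.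
clearbody b1 m b2; exists b1, m, b2; split=> //; last by rewrite -gm.
split=> //; have -> : m = invmx b1 *m g *m invmx b2.
  by rewrite gm !mulmxA mulVmx// mul1mx mulmxK.
apply: group_setM; last exact: group_setV.
by apply: group_setM => //; exact: group_setV.
Qed.

(** The roots of Phi_w as a relation. Its transitivity is what makes U_w stable under inverses. *)
Definition inversion w : rel 'I_n :=
  fun i j => (i < j)%N && (w^-1%g j < w^-1%g i)%N.

Lemma inversion_trans w : transitive (inversion w).
Proof.
by move=> b a c /andP[ab ab'] /andP[bc bc']; rewrite /inversion (ltn_trans ab)// (ltn_trans bc').
Qed.

Lemma inversion_ltn w i j : inversion w i j -> (i < j)%N.
Proof. by case/andP. Qed.

(** Splits off the U_w part of B. The matrix Y = u^-1 is built row by row so that Y B vanishes at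
    the inversions; conjugation by w then leaves it upper triangular. *)
Lemma upper_perm_factor w B : upper_mx B -> B \in unitmx ->
  exists u B', [/\ unipotent_on (inversion w) u, upper_mx B', B' \in unitmx
    & B *m perm_mx w^-1 = u *m perm_mx w^-1 *m B'].
Proof.
move=> Bup Bu; have Blt := elimT (upper_mxP _) Bup.
have /choice[r rP] i : exists r : 'rV[K]_n,
    (forall l, ~~ inversion w i l -> r 0 l = 0) /\
    (forall j, inversion w i j -> B i j + \sum_l r 0 l * B l j = 0).
  pose J := inversion w i.
  (* The block of B on the inversions of i, padded by the identity: it is triangular and invertible,
     so the equations for row i have a solution. *)
  pose C : 'M[K]_n := \matrix_(l, j) if J l && J j then B l j else (l == j)%:R.
  have Cup : upper_mx C.
    apply/upper_mxP => a b ba; rewrite mxE Blt//.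
    by rewrite -[a == b]val_eqE (gtn_eqF ba); case: ifP.
  have Cu : C \in unitmx.
    rewrite upper_unitmx//; apply/forallP => a; rewrite mxE eqxx.
    by case: ifP => _; rewrite ?oner_eq0// upper_diag_neq0.
  pose r := (\row_j if J j then - B i j else 0) *m invmx C.
  have rE j : \sum_l r 0 l * C l j = if J j then - B i j else 0.
    have -> : \sum_l r 0 l * C l j = (r *m C) 0 j by rewrite mxE.
    by rewrite mulmxKV// mxE.
  clearbody r; have r0 l : ~~ J l -> r 0 l = 0.
    move=> Jl; have := rE l; rewrite (negPf Jl) (bigD1 l)//= big1 ?addr0.
      by rewrite mxE (negPf Jl) andbF eqxx mulr1.
    by move=> m /negPf ml; rewrite mxE (negPf Jl) andbF ml mulr0.
  exists r; split=> // j Jj; have := rE j; rewrite /J in Jj *; rewrite Jj.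
  move=> rEj; rewrite -[B i j]opprK -rEj addrC; apply/eqP; rewrite subr_eq0.
  apply/eqP/eq_bigr => l _; rewrite mxE /J Jj andbT; case: ifP => // /negbT Jl.
  by rewrite r0// !mul0r.
pose Y := \matrix_(i, l) ((i == l)%:R + r i 0 l).
have YP : unipotent_on (inversion w) Y.
  split=> [i|i j ij]; rewrite mxE.
    by have [-> //] := rP i; rewrite ?eqxx ?addr0// /inversion ltnn.
  by rewrite (negPf ij) add0r; apply: contra_neqT; have [+ _] := rP i; apply.
have Yu := unitmx_unipotent_on (@inversion_ltn w) YP.
pose B' := perm_mx w *m (Y *m B) *m perm_mx w^-1.
have B'E i j : B' i j = (Y *m B) (w i) (w j).
  by rewrite /B' perm_conjE.
exists (invmx Y), B'; split.
- exact: invmx_unipotent_on (@inversion_trans w) (@inversion_ltn w) YP.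
- apply/upper_mxP => i j ji; rewrite B'E mxE.
  have -> : \sum_l Y (w i) l * B l (w j) =
      B (w i) (w j) + \sum_l r (w i) 0 l * B l (w j).
    under eq_bigr do rewrite mxE mulrDl; rewrite big_split /=; congr (_ + _).
    rewrite (bigD1 (w i))//= eqxx mul1r big1 ?addr0// => l /negPf li.
    by rewrite eq_sym li mul0r.
  have [r0 rB] := rP (w i).
  (* For j < i, the pair (w i, w j) is either an inversion, cleared by Y, or below the diagonal,
     where Y B vanishes anyway. *)
  have [wij|wji] := ltnP (w i) (w j).
    by apply: rB; rewrite /inversion wij !permK.
  have wji' : (w j < w i)%N.
    rewrite ltn_neqAle wji andbT val_eqE (inj_eq perm_inj).
    by rewrite -val_eqE ltn_eqF.
  rewrite Blt// add0r big1// => l _.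
  have [/inversion_ltn il|/r0 ->] := boolP (inversion w (w i) l); last by rewrite mul0r.
  by rewrite Blt ?mulr0// (ltn_trans wji' il).
- by rewrite !unitmx_mul !unitmx_perm Yu Bu.
have PP : perm_mx w^-1 *m perm_mx w = 1%:M :> 'M[K]_n.
  by rewrite -perm_mxM mulVg perm_mx1.
by rewrite /B' !mulmxA -(mulmxA (invmx Y)) PP mulmx1 mulVmx// mul1mx.
Qed.

End SchubertCells.

(** * Minors that recover the lower factor of a triangular factorization *)

Section Minors.
Variables (K : fieldType) (n : nat).
Implicit Types (h B : 'M[K]_n) (i j : 'I_n).

Definition minor_row i j (a : 'I_j.+1) : 'I_n :=
  if (a < j)%N then widen_ord (ltn_ord j) a else i.

(** If h = L B with L lower unitriangular and B upper triangular and invertible, then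
    [minor i j h / minor j j h] is the entry (i, j) of L. *)
Definition minor i j h : K :=
  \det (mxsub (minor_row i (j := j)) (widen_ord (ltn_ord j)) h).

Definition leading_minor j B : K :=
  \det (mxsub (widen_ord (ltn_ord j)) (widen_ord (ltn_ord j)) B).

(** The first j + 1 columns of h B involve only the first j + 1 columns of h, so the submatrix of
    the product is a product of square submatrices. *)
Lemma minor_mul_upper i j h B : upper_mx B ->
  minor i j (h *m B) = minor i j h * leading_minor j B.
Proof.
move=> /upper_mxP Bup; rewrite -det_mulmx; congr (\det _).
apply/matrixP => a b; rewrite !mxE.
rewrite (bigID (fun l : 'I_n => l < j.+1)%N) /= [X in _ + X]big1 ?addr0 => [|l].
  rewrite (big_ord_narrow (ltn_ord j)); apply: eq_bigr => l _.
  by rewrite !mxE.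
rewrite -leqNgt => jl; rewrite Bup ?mulr0//=.
by have := ltn_ord b; lia.
Qed.

Lemma leading_minor_neq0 j B : upper_mx B -> B \in unitmx ->
  leading_minor j B != 0.
Proof.
move=> Bup Bu; rewrite /leading_minor det_upper.
  by apply/prodf_neq0 => a _; rewrite mxE upper_diag_neq0.
apply/upper_mxP => a b ba; rewrite mxE.
exact: (elimT (upper_mxP _) Bup).
Qed.

Lemma minor_lower i j h : (forall a b : 'I_n, (a < b)%N -> h a b = 0) ->
  (forall a, h a a = 1) -> minor i j h = h i j.
Proof.
move=> hlow h1; rewrite /minor det_trig; last first.
  apply/is_trig_mxP => a b ab; rewrite mxE /minor_row ifT; first exact: hlow.
  by have := ltn_ord b; lia.
have -> : h i j = h i (widen_ord (ltn_ord j) ord_max).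
  by congr (h i _); exact: val_inj.
rewrite (bigD1 ord_max)//= big1 ?mulr1 => [|a aj].
  by rewrite mxE /minor_row /= ltnn.
rewrite mxE /minor_row ifT ?h1//.
by have := ltn_ord a; move: aj; rewrite -val_eqE /=; lia.
Qed.

End Minors.

Section PolynomialMatrices.
Variables (K : fieldType) (n : nat).

Lemma polyfun_matrix_entry (i j : 'I_n) :
  polyfun (fun (A : 'M[K]_n) l => mxvec A 0 l) (fun A => A i j).
Proof.
have [p pE] := polyfun_coord (fun (A : 'M[K]_n) l => mxvec A 0 l) (mxvec_index i j).
by exists p => A; rewrite -pE mxvecE.
Qed.

Lemma polyfun_coords Q (i j : 'I_n) :
  polyfun (fun (A : 'M[K]_n) l => mxvec A 0 l) (fun A => coords Q A i j).
Proof.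
have algP := polyfun_algebra (fun (A : 'M[K]_n) l => mxvec A 0 l).
have polyC : forall c : K, polyfun (fun (A : 'M[K]_n) l => mxvec A 0 l) (fun=> c).
  by case: algP.
move: i j; apply: (function_algebra_mulmx algP) => [|i j]; last exact: polyC.
apply: (function_algebra_mulmx algP) => i j; first exact: polyC.
exact: polyfun_matrix_entry.
Qed.

End PolynomialMatrices.

(** * Charts on Schubert cells *)

Section SchubertSlices.
Variables (K : fieldType) (n : nat) (k : linear_group) (Q : 'M[K]_n).
Hypothesis Qu : Q \in unitmx.
Variable w : 'S_n.
Implicit Types (g u Y : 'M[K]_n).

Local Notation unip := (unipotent_on (inversion w)).
Local Notation cmx := (fun (A : 'M[K]_n) l => mxvec A 0 l).

Lemma unip_unitmx u : unip u -> u \in unitmx.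
Proof. exact: unitmx_unipotent_on (@inversion_ltn n w). Qed.

Lemma unip_invmx u : unip u -> unip (invmx u).
Proof. exact: invmx_unipotent_on (@inversion_trans n w) (@inversion_ltn n w). Qed.

Lemma unip_det u : unip u -> \det u = 1.
Proof. exact: det_unipotent_on (@inversion_ltn n w). Qed.

Lemma unip_adj u : unip u -> \adj u = invmx u.
Proof.
by move=> Uu; rewrite /invmx unip_unitmx// unip_det// invr1 scale1r.
Qed.

(** A representative of u w B; [t] is chosen to give it determinant 1, which suits both groups. *)
Definition cell_point (t : 'rV[K]_n) u : 'M[K]_n :=
  Ad Q (u *m perm_mx w^-1 *m diag_mx t).

(* w v w^-1, where v is the lower unipotent factor of w^-1 g in the big cell. *)
Definition chart g : 'M[K]_n :=
  let h := perm_mx w *m coords Q g in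
  \matrix_(a, b) (minor (w^-1%g a) (w^-1%g b) h / minor (w^-1%g b) (w^-1%g b) h).

Definition chart_denominator g : K :=
  \prod_j minor j j (perm_mx w *m coords Q g).

Section Torus.
Variable t : 'rV[K]_n.
Hypothesis t_neq0 : forall i, t 0 i != 0.
Hypothesis det_t : \det (perm_mx w^-1 : 'M[K]_n) * \det (diag_mx t) = 1.

Lemma unitmx_torus : diag_mx t \in unitmx.
Proof. by rewrite unitmx_diag; apply/forallP. Qed.

Lemma group_set_cell_point u : unip u -> group_set k (cell_point t u).
Proof.
move=> Uu; apply: det1_group_set; rewrite det_Ad// !det_mulmx -mulrA det_t.
by rewrite unip_det// mulr1.
Qed.

Lemma schubert_cellP x : schubert_cell k Q w x <->
  exists2 u, unip u & x = coset k Q (cell_point t u).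
Proof.
split=> [/(schubert_cell_coordsP k Qu)[g [B1 [B2 [Gg -> [B1up B1u] [B2up B2u] gE]]]]|].
  have [u [B' [Uu B'up B'u B1E]]] := upper_perm_factor w B1up B1u.
  exists u => //; pose B := invmx (diag_mx t) *m B' *m B2.
  have Gu := group_set_cell_point Uu.
  apply: (eq_coset_coords Qu (B := B)) (group_set_unitmx Gu) Gu Gg _ _.
    apply: upper_mulmx => //; apply: upper_mulmx => //.
    by apply: upper_invmx; [exact: upper_diag_mx|exact: unitmx_torus].
  rewrite coords_Ad// gE B1E /B !mulmxA mulmxK//; exact: unitmx_torus.
move=> [u Uu ->]; apply/(schubert_cell_coordsP k Qu).
exists (cell_point t u), u, (diag_mx t); split=> //.
- exact: group_set_cell_point.
- split; last exact: unip_unitmx.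
  exact: unipotent_on_upper (@inversion_ltn n w) Uu.
- by split; [exact: upper_diag_mx|exact: unitmx_torus].
- by rewrite coords_Ad.
Qed.

(** For u in U_w the conjugate w^-1 u w is lower unitriangular, so these minors of it are its
    entries. *)
Lemma minor_cell_point u i j : unip u ->
  minor i j (perm_mx w *m coords Q (cell_point t u)) =
  u (w i) (w j) * leading_minor j (diag_mx t).
Proof.
move=> [u1 uw]; rewrite coords_Ad// mulmxA minor_mul_upper ?upper_diag_mx//.
congr (_ * _); have hE (a b : 'I_n) : (perm_mx w *m (u *m perm_mx w^-1)) a b = u (w a) (w b).
  by rewrite mulmxA perm_conjE.
rewrite minor_lower => [|a b ab|a]; rewrite hE//.
apply/eqP; apply: contraTT ab => uab.
have [->|ab] := eqVneq a b; first by rewrite ltnn.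
have wab : w a != w b by rewrite (inj_eq perm_inj).
have /andP[_] := uw _ _ wab uab; rewrite !permK -leqNgt; exact: ltnW.
Qed.

Lemma leading_minor_torus j : leading_minor j (diag_mx t) != 0.
Proof. by apply: leading_minor_neq0; rewrite ?upper_diag_mx ?unitmx_torus. Qed.

Lemma chart_cell_point u : unip u -> chart (cell_point t u) = u.
Proof.
move=> Uu; apply/matrixP => a b; rewrite mxE !minor_cell_point// !permKV.
by case: Uu => -> _; rewrite mul1r mulfK// leading_minor_torus.
Qed.

Lemma chart_denominator_cell_point u : unip u ->
  chart_denominator (cell_point t u) != 0.
Proof.
move=> Uu; apply/prodf_neq0 => j _; rewrite minor_cell_point//.
by case: Uu => -> _; rewrite mul1r leading_minor_torus.
Qed.

End Torus.

Lemma minor_borel g b i j : borel k Q b ->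
  minor i j (perm_mx w *m coords Q (g *m b)) =
  minor i j (perm_mx w *m coords Q g) * leading_minor j (coords Q b).
Proof. by move=> [_ bup]; rewrite coords_mul// mulmxA minor_mul_upper. Qed.

Lemma leading_minor_borel b j : borel k Q b -> leading_minor j (coords Q b) != 0.
Proof.
move=> [Gb bup]; apply: leading_minor_neq0 => //.
by rewrite unitmx_coords//; exact: group_set_unitmx Gb.
Qed.

Lemma chart_borel g b : borel k Q b -> chart (g *m b) = chart g.
Proof.
move=> Bb; apply/matrixP => i j; rewrite !mxE !minor_borel//.
by rewrite -mulf_div divff ?mulr1//; exact: leading_minor_borel.
Qed.

Lemma chart_denominator_borel g b : borel k Q b ->
  chart_denominator g != 0 -> chart_denominator (g *m b) != 0.
Proof.
move=> Bb /prodf_neq0 g0; apply/prodf_neq0 => j _.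
by rewrite minor_borel// mulf_neq0 ?g0//; exact: leading_minor_borel.
Qed.

Lemma polyfun_minor i j :
  polyfun cmx (fun g => minor i j (perm_mx w *m coords Q g)).
Proof.
have algP := polyfun_algebra (K := K) (d := n * n) cmx; have [polyC _ _] := algP.
have hP a b : polyfun cmx (fun g => (perm_mx w *m coords Q g) a b).
  move: a b; apply: (function_algebra_mulmx algP) => c e; last exact: polyfun_coords.
  exact: polyC.
rewrite /minor; apply: (function_algebra_det (A := fun g =>
  mxsub (minor_row i (j := j)) (widen_ord (ltn_ord j)) (perm_mx w *m coords Q g)) algP).
move=> a b; rewrite (_ : (fun g => _) = fun g =>
  (perm_mx w *m coords Q g) (minor_row i a) (widen_ord (ltn_ord j) b)) //.
by apply/funext => g; rewrite mxE.
Qed.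

Lemma polyfun_chart_denominator : polyfun cmx chart_denominator.
Proof.
apply: (function_algebra_prod (polyfun_algebra cmx)) => j; exact: polyfun_minor.
Qed.

Lemma ratfun_chart A (a b : 'I_n) : ratfun cmx A chart_denominator (fun g => chart g a b).
Proof.
have algP := polyfun_algebra (K := K) (d := n * n) cmx; have [_ _ polyM] := algP.
pose M i j g := minor i j (perm_mx w *m coords Q g).
pose a' := w^-1%g a; pose b' := w^-1%g b.
(* Expanding by the other principal minors reaches the common denominator. *)
exists (fun g => M a' b' g * \prod_(j | j != b') M j j g), 1%N; split.
  apply: polyM; first exact: polyfun_minor.
  apply: (function_algebra_prod algP) => j; exact: polyfun_minor.
move=> g _; rewrite /chart_denominator (bigD1 b')//= mulf_eq0 negb_or.
move=> /andP[Mb Mj]; rewrite mxE expr1 -mulf_div divff ?mulr1//.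
Qed.

(** Reduces the geometry of a cell to matrix algebra: it suffices to parametrize the admissible Y =
    u^-1 polynomially in such a way that the parameters are entries of Y. *)
Lemma schubert_slice_iso (Free : {set 'I_n * 'I_n}) (H : set (set 'M[K]_n))
    (Yp : 'rV[K]_#|Free| -> 'M[K]_n) (t : 'rV[K]_n) :
  (forall i, t 0 i != 0) ->
  \det (perm_mx w^-1 : 'M[K]_n) * \det (diag_mx t) = 1 ->
  (forall i j, polyfun (fun (y : 'rV[K]_#|Free|) l => y 0 l) (fun y => Yp y i j)) ->
  (forall y, unip (Yp y)) ->
  (forall y, H (coset k Q (cell_point t (invmx (Yp y))))) ->
  (forall y l, Yp y (enum_val l).1 (enum_val l).2 = y 0 l) ->
  (forall Y, unip Y -> H (coset k Q (cell_point t (invmx Y))) ->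
     Yp (\row_l Y (enum_val l).1 (enum_val l).2) = Y) ->
  isomorphic (subspace (subspace (flag_variety k Q) H) (schubert_cell k Q w `&` H))
    (affine_space K #|Free|).
Proof.
move=> t0 dt YpP Ypu YpH Ypfree Yp_surj.
(* The representative picked by [xget] is irrelevant because [chart] is invariant under B. On U_w
   the adjugate is the inverse, and it is polynomial in the entries. *)
pose F (x : set 'M[K]_n) : 'rV[K]_#|Free| :=
  \row_l (\adj (chart (xget 1%:M x))) (enum_val l).1 (enum_val l).2.
pose E (y : 'rV[K]_#|Free|) := coset k Q (cell_point t (invmx (Yp y))).
have chart_coset g : chart (xget 1%:M (coset k Q g)) = chart g.
  have [b Bb <-] : coset k Q g (xget 1%:M (coset k Q g)).
    by apply: xgetPex; exists g; exact: mem_coset.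
  exact: chart_borel.
have FE u : unip u -> F (coset k Q (cell_point t u)) =
    \row_l (invmx u) (enum_val l).1 (enum_val l).2.
  move=> Uu; apply/rowP => l; rewrite !mxE chart_coset chart_cell_point//.
  by rewrite -unip_adj// mxE.
have EY y : unip (invmx (Yp y)) by exact: unip_invmx.
exists F, E; split.
- apply: subspace_subspace_morphism; first by move=> x [].
  apply: (@rational_morphism _ _ _ cmx _ chart_denominator).
  + exact: polyfun_chart_denominator.
  + move=> l; rewrite (_ : (fun g => _) = fun g =>
        (\adj (chart g)) (enum_val l).1 (enum_val l).2); last first.
      by apply/funext => g; rewrite mxE chart_coset.
    apply: (function_algebra_adj (ratfun_algebra _ polyfun_chart_denominator)).
    exact: ratfun_chart.
  + by move=> g h Gg Gh /(eq_coset Qu)[b Bb ->]; exact: chart_denominator_borel.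
  + move=> x [/(schubert_cellP t0 dt)[u Uu ->] _].
    exists (cell_point t u); split=> //; first exact: group_set_cell_point.
    exact: chart_denominator_cell_point.
- have EG y : group_set k (cell_point t (invmx (Yp y))) by exact: group_set_cell_point.
  apply: morphism_to_subspace; last first.
    move=> y; split; last exact: YpH.
    by apply/(schubert_cellP t0 dt); exists (invmx (Yp y)).
  apply: morphism_to_subspace; last by [].
  apply: is_morphism_comp (quotient_map_morphism _ _).
  apply: morphism_to_subspace; last by [].
  apply: polynomial_morphism => l; case/mxvec_indexP: l => a b.
  rewrite (_ : (fun y => _) = fun y => cell_point t (\adj (Yp y)) a b); last first.
    by apply/funext => y; rewrite mxvecE unip_adj.
  have algP := polyfun_algebra (fun (y : 'rV[K]_#|Free|) l => y 0 l).
  have polyC : forall c : K, polyfun (fun (y : 'rV[K]_#|Free|) l => y 0 l) (fun=> c).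
    by case: algP.
  move: a b; apply: (function_algebra_mulmx algP) => [a b|a b]; last exact: polyC.
  move: a b; apply: (function_algebra_mulmx algP) => [a b|]; first exact: polyC.
  apply: (function_algebra_mulmx algP) => [|a b]; last exact: polyC.
  apply: (function_algebra_mulmx algP) => [|a b]; last exact: polyC.
  exact: function_algebra_adj.
- move=> x [_ [/(schubert_cellP t0 dt)[u Uu ->] Hx]].
  have Uu' : unip (invmx u) by exact: unip_invmx.
  by rewrite FE// /E Yp_surj ?invmxK.
- move=> y _; rewrite /E FE//; apply/rowP => l.
  by rewrite mxE invmxK.
Qed.

End SchubertSlices.

(** * Hessenberg spaces and roots *)

Section HessenbergSpaces.
Variables (K : numFieldType) (n : nat) (k : linear_group) (Q : 'M[K]_n).
Variable (H : {vspace 'M[K]_n}).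
Hypothesis Qu : Q \in unitmx.
Hypothesis hessH : hessenberg_space k Q H.
Implicit Types (A B X Y : 'M[K]_n) (i j p q : 'I_n).

Lemma mxtrace_Ad A : \tr (Ad Q A) = \tr A.
Proof. by rewrite /Ad mxtrace_mulC mulmxA mulVmx// mul1mx. Qed.

Lemma mxtrace_coords A : \tr (coords Q A) = \tr A.
Proof. by rewrite -(mxtrace_Ad (coords Q A)) Ad_coords. Qed.

(** For SL_n, A need not be traceless; subtracting the scalar matrix of the same trace puts it into
    the Lie algebra without changing the bracket. *)
Lemma upper_bracket A B : upper_mx A -> Ad Q B \in H -> Ad Q (A *m B - B *m A) \in H.
Proof.
move=> Aup BH; pose c := \tr A / n%:R; pose A' := A - c%:M.
have [_ _ brH] := hessH.
have -> : Ad Q (A *m B - B *m A) = Ad Q A' *m Ad Q B - Ad Q B *m Ad Q A'.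
  have -> : A *m B - B *m A = A' *m B - B *m A'.
    by rewrite mulmxBl mulmxBr scalar_mxC opprB addrA subrK.
  by rewrite -!Ad_mul// /Ad mulmxBr mulmxBl.
apply: brH => //; split; last first.
  rewrite coords_Ad//; apply/upper_mxP => i j ji; rewrite !mxE.
  by rewrite -[i == j]val_eqE (gtn_eqF ji) subr0; exact: (upper_mxP _ Aup).
case: (k) => //=; rewrite mxtrace_Ad /A' raddfB /= mxtrace_scalar /c.
case: (posnP n) => [n0|n0]; last first.
  by rewrite -[X in _ - X]mulr_natr mulfVK ?subrr// pnatr_eq0 -lt0n.
have -> : \tr A = 0.
  by rewrite /mxtrace big1// => i; have := ltn_ord i; rewrite [X in (_ < X)%N]n0.
by rewrite mul0r mul0rn subr0.
Qed.

Lemma AdD A B : Ad Q (A + B) = Ad Q A + Ad Q B.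
Proof. by rewrite /Ad mulmxDr mulmxDl. Qed.

Lemma AdZ c A : Ad Q (c *: A) = c *: Ad Q A.
Proof. by rewrite /Ad -scalemxAr -scalemxAl. Qed.

(** H is stable under the torus, so it contains the root components of its elements. They are
    isolated by brackets with the idempotents E_aa, which multiply the entry (b, c) by [b = a] -
    [c = a]. *)
Lemma root_component A i j : Ad Q A \in H -> i != j -> A i j != 0 ->
  Ad Q (delta_mx i j) \in H.
Proof.
move=> AH ij Aij.
have [br brH brE] : exists2 br : 'I_n -> 'M[K]_n -> 'M[K]_n,
    (forall a X, Ad Q X \in H -> Ad Q (br a X) \in H) &
    forall a X b c, br a X b c = ((b == a)%:R - (c == a)%:R) * X b c.
  exists (fun a X => mask K (pred1 a) *m X - X *m mask K (pred1 a)).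
    by move=> a X; apply: upper_bracket; exact: upper_diag_mx.
  move=> a X b c; rewrite mxE [X in _ + X]mxE mul_maskl mul_maskr /= mulrBl.
  by congr (_ - _); rewrite mulrC.
(* Only the entries (i, j) and (j, i) survive in [C], both with factor -1; adding [br i C] doubles
   the first and cancels the second, whence the factor -1/2. *)
pose C := br j (br i A).
have CH : Ad Q (C + br i C) \in H by rewrite AdD rpredD// !brH.
have := rpredZ (- 2^-1 * (A i j)^-1) CH; rewrite -AdZ.
congr (Ad Q _ \in H); apply/matrixP => a b; rewrite !mxE /C !brE.
have [->|ai] := eqVneq a i.
  rewrite (negPf ij); have [->|bj] := eqVneq b j.
    by rewrite [j == i]eq_sym (negPf ij) /=; field.
  by rewrite andbF subrr !(mul0r, mulr0, addr0).
rewrite andFb !sub0r; have [->|bi] := eqVneq b i.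
  by rewrite !mulN1r addrN mulr0.
by rewrite oppr0 !mul0r !mulr0 addr0 mulr0.
Qed.

(** On the diagonal, SL_n relies on the first disjunct, since [delta_mx i i] is not traceless. *)
Definition allowed : rel 'I_n :=
  fun i j => (i <= j)%N || (Ad Q (delta_mx i j) \in H).

(** Hessenberg spaces are staircases: the bracket with E_ip moves a root vector up its column, the
    bracket with E_qj moves it to the right in its row. *)
Lemma allowed_up p q i j : allowed p q -> (i <= p)%N -> (q <= j)%N -> allowed i j.
Proof.
move=> /orP[pq|pqH] ip qj; rewrite /allowed.
  by rewrite (leq_trans ip (leq_trans pq qj)).
(* Once q <= j < i, one of the two products in each bracket vanishes. *)
have [//|ji /=] := leqP i j.
have delta_up (a b : 'I_n) : (a <= b)%N -> upper_mx (delta_mx a b : 'M[K]_n).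
  move=> ab; apply/upper_mxP => c d dc; rewrite mxE.
  by case: eqP => //= ca; case: eqP => //= db; move: dc; rewrite ca db; lia.
have iqH : Ad Q (delta_mx i q) \in H.
  have [<-//|pi] := eqVneq p i.
  have := upper_bracket (delta_up i p ip) pqH.
  rewrite mul_delta_mx mul_delta_mx_0 ?subr0//.
  by apply: contraTneq ji => <-; rewrite -leqNgt.
have [<-//|jq] := eqVneq q j.
have := upper_bracket (delta_up q j qj) iqH.
rewrite mul_delta_mx mul_delta_mx_0 ?sub0r; last first.
  by apply: contraTneq ji => <-; rewrite ltnn.
by rewrite -scaleN1r AdZ scaleN1r rpredN.
Qed.

(** The upper triangular part carries the whole trace and lies in the Borel algebra; what remains is
    a combination of negative root vectors of H. *)
Lemma mem_hessenberg X :
  X \in H <-> lie_algebra k X /\ forall i j, coords Q X i j != 0 -> allowed i j.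
Proof.
have [bH Hg _] := hessH; split=> [XH|[gX Xall]].
  split=> [|i j Xij]; first exact: Hg.
  rewrite /allowed; have [->|ij] := eqVneq i j; first by rewrite leqnn.
  by rewrite (root_component _ ij Xij) ?orbT// Ad_coords.
move: (Ad_coords X Qu) (mxtrace_coords X) Xall; move: (coords Q X) => A XE trA Aall.
pose U : 'M[K]_n := \matrix_(i, j) (A i j *+ (i <= j)%N).
have AE : A = U + \sum_i \sum_j (A i j *+ (j < i)%N) *: delta_mx i j.
  apply/matrixP => i j; rewrite mxE summxE (bigD1 i)//= [X in _ + (_ + X)]big1 => [|a ai].
    rewrite addr0 summxE (bigD1 j)//= big1 => [|b bj].
      rewrite !mxE !eqxx /= mulr1 addr0 ltnNge; case: (i <= j)%N => /=;
      by rewrite ?mulr1n ?mulr0n ?addr0 ?add0r.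
    by rewrite !mxE eqxx /= eq_sym (negPf bj) mulr0.
  by rewrite summxE big1// => b _; rewrite !mxE eq_sym (negPf ai) mulr0.
rewrite -XE AE AdD rpredD//.
  apply: bH; split; last first.
    rewrite coords_Ad//; apply/upper_mxP => i j ji.
    by rewrite mxE leqNgt ji mulr0n.
  case: (k) gX => //= trX; rewrite mxtrace_Ad -trX -trA.
  by apply: eq_bigr => i _; rewrite mxE leqnn mulr1n.
rewrite /Ad mulmx_sumr mulmx_suml rpred_sum// => i _.
rewrite mulmx_sumr mulmx_suml rpred_sum// => j _.
rewrite -/(Ad Q _) AdZ; have [ij|ji] := leqP i j.
  by rewrite mulr0n scale0r rpred0.
have [->|Aij] := eqVneq (A i j) 0; first by rewrite mul0rn scale0r rpred0.
apply: rpredZ; have := Aall i j Aij; rewrite /allowed leqNgt ji; exact.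
Qed.

Lemma allowed_conj A B C : upper_mx B -> upper_mx C ->
  (forall i j, A i j != 0 -> allowed i j) ->
  forall i j, (B *m A *m C) i j != 0 -> allowed i j.
Proof.
move=> /upper_mxP Bup /upper_mxP Cup Aall i j; apply: contraNT => nij.
apply/eqP; rewrite mxE big1// => l _.
have [jl|lj] := ltnP j l; first by rewrite Cup ?mulr0.
rewrite mxE big1 ?mul0r// => m _.
have [mi|im] := ltnP m i; first by rewrite Bup ?mul0r.
have [->|/Aall ml] := eqVneq (A m l) 0; first by rewrite mulr0.
by rewrite (allowed_up ml im lj) in nij.
Qed.

Variable N : 'M[K]_n.
Hypothesis lieN : lie_algebra k N.

Lemma lie_algebra_Ad g : g \in unitmx -> lie_algebra k (Ad (invmx g) N).
Proof.
move=> gu; case: (k) lieN => //= trN.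
by rewrite /Ad invmxK mxtrace_mulC mulmxA mulmxV// mul1mx.
Qed.

Lemma hessenberg_varietyP g : group_set k g ->
  hessenberg_variety k Q N H (coset k Q g) <->
  forall i j, coords Q (Ad (invmx g) N) i j != 0 -> allowed i j.
Proof.
move=> Gg; have gu := group_set_unitmx Gg.
split=> [[h [Gh /mem_hessenberg[_ hall]]]|gall]; last first.
  by exists g; split=> //; apply/mem_hessenberg; split=> //; exact: lie_algebra_Ad.
move=> /esym/(eq_coset Qu)[b [Gb bup] gE].
have hu := group_set_unitmx Gh; have bu := group_set_unitmx Gb.
rewrite gE /Ad !invmxK !invmx_mulmx// in hall *.
have -> : invmx b *m invmx h *m N *m (h *m b) =
    invmx b *m (invmx h *m N *m h) *m b by rewrite !mulmxA.
rewrite !(coords_mul _ _ Qu) in hall *.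
apply: allowed_conj => //.
by rewrite coords_invmx//; apply: upper_invmx => //; rewrite unitmx_coords.
Qed.

Definition allowed_by (w : 'S_n) : rel 'I_n :=
  fun i j => allowed (w^-1%g i) (w^-1%g j).

Lemma weyl_mem_hessenberg (w : 'S_n) : Ad (invmx (weyl_mx Q w)) N \in H <->
  forall i j, coords Q N i j != 0 -> allowed_by w i j.
Proof.
have wu : weyl_mx Q w \in unitmx.
  by rewrite -(unitmx_coords _ Qu) coords_weyl_mx// unitmx_perm.
have NE i j : coords Q (Ad (invmx (weyl_mx Q w)) N) i j = coords Q N (w i) (w j).
  rewrite /Ad invmxK 2?coords_mul// coords_invmx// coords_weyl_mx//.
  by rewrite invmx_perm_mxV perm_conjE.
split=> [/mem_hessenberg[_ Nall] i j Nij|Nall].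
  by apply: Nall; rewrite NE !permKV.
apply/mem_hessenberg; split=> [|i j]; first exact: lie_algebra_Ad.
by rewrite NE => /Nall; rewrite /allowed_by !permK.
Qed.

Lemma cell_point_hessenberg (w : 'S_n) (t : 'rV[K]_n) (u : 'M[K]_n) : (forall i, t 0 i != 0) ->
  group_set k (cell_point Q w t u) -> u \in unitmx ->
  hessenberg_variety k Q N H (coset k Q (cell_point Q w t u)) <->
  forall i j, (invmx u *m coords Q N *m u) i j != 0 -> allowed_by w i j.
Proof.
move=> t0 Gg uu; rewrite hessenberg_varietyP//.
have tu : diag_mx t \in unitmx by rewrite unitmx_diag; apply/forallP.
have gu := group_set_unitmx Gg.
have pu : perm_mx w^-1 \in @unitmx K n by exact: unitmx_perm.
set M := invmx u *m coords Q N *m u.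
have ->: coords Q (Ad (invmx (cell_point Q w t u)) N) =
    invmx (diag_mx t) *m (perm_mx w *m M *m perm_mx w^-1) *m diag_mx t.
  have: coords Q (cell_point Q w t u) = u *m perm_mx w^-1 *m diag_mx t.
    exact: coords_Ad.
  move: (cell_point _ _ _ _) gu => g gu gE.
  rewrite /Ad invmxK 2?coords_mul// coords_invmx// gE.
  by rewrite !invmx_mulmx ?unitmx_mul ?uu ?pu// invmx_perm_mxV /M !mulmxA.
have tup : upper_mx (diag_mx t) by exact: upper_diag_mx.
have tVup : upper_mx (invmx (diag_mx t)) by exact: upper_invmx.
split=> Mall i j.
  move=> Mij; suff all' a b : (perm_mx w *m M *m perm_mx w^-1) a b != 0 -> allowed a b.
    by apply: all'; rewrite perm_conjE !permKV.
  have conj := allowed_conj tup tVup Mall; have := conj a b.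
  by rewrite !mulmxA mulmxV// mul1mx mulmxK.
apply: allowed_conj => // a b; rewrite perm_conjE => /Mall.
by rewrite /allowed_by !permK.
Qed.

End HessenbergSpaces.

(** * Roots as pairs of indices *)

Section Roots.
Variables (K : numFieldType) (n : nat) (k : linear_group) (Q : 'M[K]_n).
Hypothesis Qu : Q \in unitmx.
Implicit Types (a : 'I_n * 'I_n) (w : 'S_n).

Lemma mem_positive_roots a : (a \in positive_roots k Q) = (a.1 < a.2)%N.
Proof.
rewrite !inE; apply/andP/idP => [[aneq /asboolP/(_ _ (memv_line _))[_]]|alt].
  rewrite coords_Ad// => /upper_mxP aup; rewrite ltnNge leq_eqVlt val_eqE.
  rewrite [_ == _]eq_sym (negPf aneq) /=; apply/negP => /aup.
  by rewrite mxE !eqxx => /eqP; rewrite oner_eq0.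
split; first by rewrite -val_eqE ltn_eqF.
apply/asboolP => _ /vlineP[c ->]; rewrite -AdZ; split.
  case: k => //=; rewrite mxtrace_Ad// linearZ /= /mxtrace big1 ?mulr0// => i _.
  rewrite mxE; case: eqP => //= ->; case: eqP => // ea.
  by rewrite ea ltnn in alt.
rewrite coords_Ad//; apply/upper_mxP => i j ji; rewrite !mxE.
case: eqP => [ia|_]; last by rewrite mulr0.
by case: eqP => [ja|_]; rewrite ?mulr0//; move: ji; rewrite ia ja; lia.
Qed.

Lemma mem_negative_roots a : (a \in negative_roots k Q) = (a.2 < a.1)%N.
Proof.
apply/imsetP/idP => [[b + ->]|alt]; first by rewrite mem_positive_roots.
by exists (a.2, a.1); rewrite ?mem_positive_roots//; case: a {alt}.
Qed.

Lemma mem_Phi_perm w a : (a \in Phi_perm k Q w) = inversion w a.1 a.2.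
Proof.
rewrite inE mem_positive_roots /inversion; congr (_ && _).
apply/imsetP/idP => [[b + ->]|alt]; first by rewrite mem_negative_roots /= !permK.
exists (w^-1%g a.1, w^-1%g a.2); first by rewrite mem_negative_roots.
by rewrite /weyl_act /= !permKV; case: a {alt}.
Qed.

Lemma mem_C_perm w (H : {vspace 'M[K]_n}) a : hessenberg_space k Q H ->
  (a \in C_perm k Q w H) = (a.1 < a.2)%N && ~~ allowed_by Q H w a.1 a.2.
Proof.
move=> [bH _ _]; rewrite inE mem_positive_roots andbC; have [alt /=|//] := ltnP.
congr (~~ _); apply/imsetP/idP => [[b + ->]|].
  rewrite !inE -memvE => /andP[_ bH']; rewrite /allowed_by /allowed /= !permK.
  by rewrite bH' orbT.
move=> aall; exists (w^-1%g a.1, w^-1%g a.2); last first.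
  by rewrite /weyl_act /= !permKV; case: a {alt aall}.
have aneq : a.1 != a.2 by rewrite -val_eqE ltn_eqF.
rewrite !inE /= (inj_eq perm_inj) aneq -memvE /=.
move: aall; rewrite /allowed_by /allowed leq_eqVlt val_eqE (inj_eq perm_inj).
rewrite (negPf aneq) /= => /orP[wlt|//].
pose b := (w^-1%g a.1, w^-1%g a.2).
have : b \in positive_roots k Q by rewrite mem_positive_roots.
by rewrite !inE => /andP[_ /asboolP bp]; apply/bH/bp/memv_line.
Qed.

Lemma U_permP w u : U_perm k Q w u <-> unipotent_on (inversion w) (coords Q u).
Proof.
pose v := coords Q u.
have wu : weyl_mx Q w \in unitmx.
  by rewrite -(unitmx_coords _ Qu) coords_weyl_mx// unitmx_perm.
have uE i j : coords Q (Ad (invmx (weyl_mx Q w)) u) i j = v (w i) (w j).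
  rewrite /Ad invmxK 2?coords_mul// coords_invmx// coords_weyl_mx//.
  by rewrite invmx_perm_mxV perm_conjE.
split=> [[[Gu uup u1] [_ ulow _]]|Uv].
  split=> // i j ij uij; apply/andP; split.
    rewrite ltnNge leq_eqVlt val_eqE [_ == _]eq_sym (negPf ij) /=.
    by apply: contra_neqN uij => ji; exact: (upper_mxP _ uup).
  rewrite ltnNge leq_eqVlt val_eqE (inj_eq perm_inj) (negPf ij) /=.
  apply: contra_neqN uij => ji; have := is_trig_mxP ulow _ _ ji.
  by rewrite uE !permKV.
have vdet := det_unipotent_on (@inversion_ltn n w) Uv.
have udet : \det u = 1 by rewrite -(det_coords u Qu).
have [v1 vw] := Uv; split; split=> //.
- exact: det1_group_set.
- exact: unipotent_on_upper (@inversion_ltn n w) Uv.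
- apply: det1_group_set; rewrite /Ad !det_mulmx mulrAC -det_mulmx invmxK mulVmx//.
  by rewrite det1 mul1r.
- apply/is_trig_mxP => i j ij; rewrite uE; apply/eqP.
  apply: contraTT ij => vij.
  have [->|ij] := eqVneq i j; first by rewrite ltnn.
  have /andP[_] : inversion w (w i) (w j) by apply: vw; rewrite ?(inj_eq perm_inj).
  by rewrite !permK -leqNgt => /ltnW.
- by move=> i; rewrite uE v1.
Qed.

Lemma mem_Phi_of_orbit w N a :
  (a \in Phi_of_set Q [set Ad u N | u in U_perm k Q w]) <->
  a.1 != a.2 /\ exists2 Y, unipotent_on (inversion w) Y &
    (Y *m coords Q N *m invmx Y) a.1 a.2 != 0.
Proof.
rewrite inE; split=> [/asboolP[_ [u /U_permP Uu <-]]|[aneq [Y UY Ya]]].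
  rewrite !inE => /andP[aneq ua]; split=> //; exists (coords Q u) => //.
  have uu : u \in unitmx.
    by rewrite -(unitmx_coords _ Qu); exact: unitmx_unipotent_on (@inversion_ltn n w) Uu.
  by move: ua; rewrite coords_Ad_mul.
have Yu := unitmx_unipotent_on (@inversion_ltn n w) UY.
apply/asboolP; exists (Ad (Ad Q Y) N).
  by exists (Ad Q Y) => //; apply/U_permP; rewrite coords_Ad.
by rewrite !inE aneq coords_Ad_mul ?unitmx_Ad// coords_Ad.
Qed.

End Roots.

(** * Solving the conditions on U_w *)

Section ShiftElimination.
Variables (K : fieldType) (n : nat) (w : 'S_n).
Variables (sh : 'I_n -> option 'I_n) (alw : rel 'I_n).
Hypothesis sh_lt : forall i j, sh j = Some i -> (i < j)%N.
Hypothesis sh_mono : forall a b l j,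
  sh l = Some a -> sh j = Some b -> (l < j)%N -> (a < b)%N.
Hypothesis sh_up : forall a (l j : 'I_n), sh l = Some a -> (l < j)%N -> sh j != None.
Hypothesis alw_sh : forall i j, sh j = Some i -> alw i j.
Hypothesis alw_left : forall i m j : 'I_n,
  (i < m)%N -> ~~ inversion w i m -> alw m j -> alw i j.

Local Notation unip := (unipotent_on (inversion w)).
Implicit Types (Y Z : 'M[K]_n) (a b i j l m : 'I_n).

Let unip_up Y : unip Y -> upper_mx Y.
Proof. exact: unipotent_on_upper (@inversion_ltn n w). Qed.

Let Nsh : 'M[K]_n := \matrix_(i, j) (sh j == Some i)%:R.

Definition shifted Y i l : K := oapp (Y i) 0 (sh l).

Lemma mulmx_shift Y i l : (Y *m Nsh) i l = shifted Y i l.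
Proof.
rewrite mxE /shifted; case shl: (sh l) => [a|] /=.
  rewrite (bigD1 a)//= big1 ?addr0 => [|b ba]; rewrite mxE shl; first by rewrite eqxx mulr1.
  by rewrite [_ == _](negbTE _) ?mulr0//; apply: contraNneq ba => -[->].
by rewrite big1// => b _; rewrite mxE shl mulr0.
Qed.

Lemma sh_inj i l j : sh l = Some i -> sh j = Some i -> l = j.
Proof.
move=> shl shj; apply/val_inj/eqP; case: ltngtP => // [lj|jl].
  by have := sh_mono shl shj lj; rewrite ltnn.
by have := sh_mono shj shl jl; rewrite ltnn.
Qed.

Definition orbit_entry Y i j : K := (Y *m Nsh *m invmx Y) i j.

Lemma orbit_entryE Y i j : unip Y -> orbit_entry Y i j =
  shifted Y i j + \sum_(l : 'I_n | (l < j)%N) shifted Y i l * invmx Y l j.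
Proof.
move=> UY; have UZ := unip_invmx UY.
rewrite /orbit_entry mxE (bigD1 j)//= mulmx_shift; case: (UZ) => -> _.
rewrite mulr1; congr (_ + _); rewrite (bigID (fun l : 'I_n => l < j)%N) /=.
rewrite [X in _ + X]big1 ?addr0 => [|l /andP[lj]].
  apply: eq_big => [l|l _]; last by rewrite mulmx_shift.
  by rewrite -val_eqE; case: ltngtP.
rewrite -leqNgt leq_eqVlt val_eqE eq_sym (negPf lj) /= => jl.
by rewrite (elimT (upper_mxP _) (unip_up UZ))// mulr0.
Qed.

Lemma shifted_lt Y i m l : unip Y -> sh l = Some m -> (m < i)%N -> shifted Y i l = 0.
Proof.
by move=> UY shl mi; rewrite /shifted shl /= (elimT (upper_mxP _) (unip_up UY)).
Qed.

(** If sh j is undefined, so is sh l, by [sh_up]; otherwise sh l < sh j <= i, and the entry lies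
    below the diagonal of Y. *)
Lemma shifted_eq0 Y i l j : unip Y -> (l < j)%N ->
  (forall m, sh j = Some m -> (m <= i)%N) -> shifted Y i l = 0.
Proof.
move=> UY lj shj; case shl: (sh l) => [a|]; last by rewrite /shifted shl.
case shjm: (sh j) (sh_up shl lj) => [m|//] _.
by rewrite (shifted_lt UY shl)// (leq_trans (sh_mono shl shjm lj))// shj.
Qed.

Lemma orbit_entry_sh Y i j : unip Y -> sh j = Some i -> orbit_entry Y i j = 1.
Proof.
move=> UY shj; rewrite orbit_entryE// big1 => [|l lj]; last first.
  by rewrite (shifted_eq0 UY lj) ?mul0r// => m; rewrite shj => -[->].
by rewrite addr0 /shifted shj /=; case: UY.
Qed.

Lemma orbit_entry_eq0 Y i j : unip Y ->
  (forall m, sh j = Some m -> (m < i)%N) -> orbit_entry Y i j = 0.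
Proof.
move=> UY shj; rewrite orbit_entryE// big1 => [|l lj]; last first.
  by rewrite (shifted_eq0 UY lj) ?mul0r// => m /shj/ltnW.
rewrite addr0; case shjm: (sh j) => [m|]; last by rewrite /shifted shjm.
exact: (shifted_lt UY shjm) (shj m shjm).
Qed.

(** The equations that are not automatic: the orbit entry vanishes when sh j < i or sh j is
    undefined, and for sh j = i the position is allowed by [alw_sh]. *)
Definition conditions : {set 'I_n * 'I_n} := [set a : 'I_n * 'I_n |
  ~~ alw a.1 a.2 && (if sh a.2 is Some m then (a.1 < m)%N else false)].

Lemma conditionsP i j : reflect (exists2 m, sh j = Some m & ~~ alw i j && (i < m)%N)
  ((i, j) \in conditions).
Proof.
rewrite inE /=; apply: (iffP andP) => [[ij]|[m -> /andP[]//]].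
by case: (sh j) => // m im; exists m; rewrite ?ij.
Qed.

Lemma orbit_entry_neq0 Y i j : unip Y -> ~~ alw i j -> orbit_entry Y i j != 0 ->
  (i, j) \in conditions.
Proof.
move=> UY nij; apply: contra_neqT => ncond; apply: orbit_entry_eq0 => // m shj.
have [//|im] := ltnP m i; case/negP: ncond; apply/conditionsP; exists m => //.
rewrite nij ltn_neqAle im andbT; apply: contraNneq nij => /val_inj ->.
exact: alw_sh.
Qed.

Lemma orbit_allowedP Y : unip Y ->
  (forall i j, orbit_entry Y i j != 0 -> alw i j) <->
  (forall i j, (i, j) \in conditions -> orbit_entry Y i j = 0).
Proof.
move=> UY; split=> H i j.
  by move=> /conditionsP[m _ /andP[nij _]]; apply/eqP; apply: contraNT nij => /H.
move=> Xij; apply: contraT => nij.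
by move: (Xij); rewrite H ?eqxx//; exact: orbit_entry_neq0 Xij.
Qed.

(** If (i, m) were not an inversion, [alw_left] would carry the allowed position (m, j) up to (i,
    j). So each condition has its pivot among the coordinates of U_w. *)
Lemma conditions_inversion i j m : (i, j) \in conditions -> sh j = Some m ->
  inversion w i m.
Proof.
move=> /conditionsP[m' shj' /andP[nij im]] shj; apply: contraT => nw.
have mm' : m' = m by move: shj; rewrite shj' => -[].
by rewrite (alw_left _ nw (alw_sh shj)) -?mm' in nij.
Qed.

(** The column of the condition to be solved for the entry (i, m) of Y; it is unique because sh is
    injective. *)
Definition pivot i m : option 'I_n :=
  [pick j | (sh j == Some m) && ((i, j) \in conditions)].

Lemma pivotP i m j : sh j = Some m -> (i, j) \in conditions -> pivot i m = Some j.
Proof.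
move=> shj cij; rewrite /pivot; case: pickP => [l /andP[/eqP shl _]|/(_ j)].
  by rewrite (sh_inj shl shj).
by rewrite shj eqxx cij.
Qed.

Lemma pivot_Some i m j : pivot i m = Some j -> sh j = Some m /\ (i, j) \in conditions.
Proof. by rewrite /pivot; case: pickP => // l /andP[/eqP shl cl] [<-]. Qed.

Definition free_roots : {set 'I_n * 'I_n} :=
  [set a : 'I_n * 'I_n | inversion w a.1 a.2 && (pivot a.1 a.2 == None)].

Definition pivot_root (a : 'I_n * 'I_n) : 'I_n * 'I_n :=
  (a.1, odflt a.2 (sh a.2)).

(** The map (i, j) |-> (i, sh j) embeds the conditions into the inversions, and the free roots are
    the inversions outside its image. *)
Lemma card_free_roots :
  (#|free_roots| + #|conditions|)%N =
  #|[set a : 'I_n * 'I_n | inversion w a.1 a.2]%SET|.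
Proof.
set Phi := [set a | _]%SET.
have pivot_rootE i j : (i, j) \in conditions ->
    exists2 m, sh j = Some m & pivot_root (i, j) = (i, m).
  by move=> /conditionsP[m shj _]; exists m => //; rewrite /pivot_root /= shj.
have -> : #|conditions| = #|pivot_root @: conditions|.
  rewrite card_in_imset// => -[i j] [l m] /pivot_rootE[a sha ->].
  by move=> /pivot_rootE[b shb ->] [-> ab]; rewrite (sh_inj sha (j := m))// ab.
have subPhi : (pivot_root @: conditions)%SET \subset Phi.
  apply/fintype.subsetP => _ /imsetP[[i j] cij ->]; have [m shj ->] := pivot_rootE _ _ cij.
  by rewrite inE /=; exact: conditions_inversion cij shj.
rewrite -(cardsID (pivot_root @: conditions) Phi) (finset.setIidPr subPhi) addnC.
congr addn; apply: eq_card => -[i m]; rewrite !inE /= andbC; congr (_ && _).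
apply/eqP/negP => [pN /imsetP[[l j] clj]|nim].
  have [m' shj ->] := pivot_rootE _ _ clj => -[il mm'].
  by move: pN; rewrite il mm' (pivotP shj clj).
case piv: (pivot i m) => [j|//]; have [shj cij] := pivot_Some piv.
case: nim; apply/imsetP; exists (i, j) => //.
by rewrite /pivot_root /= shj.
Qed.

Definition free_mx (y : 'rV[K]_#|free_roots|) : 'M[K]_n :=
  \matrix_(i, m) \sum_s y 0 s *+ (enum_val s == (i, m)).

Lemma free_mxE y s : free_mx y (enum_val s).1 (enum_val s).2 = y 0 s.
Proof.
rewrite mxE (bigD1 s)//= -surjective_pairing eqxx big1 ?addr0// => s' ss'.
by rewrite (inj_eq enum_val_inj) (negPf ss').
Qed.

(* A matrix Y in U_w with prescribed free entries meets the conditions if and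
   only if it is a fixed point of this map, which expresses each pivot entry by
   entries of the rows below and by entries on its left in the same row. *)
Definition solve_step (y : 'rV[K]_#|free_roots|) Y : 'M[K]_n :=
  \matrix_(i, m)
    if i == m then 1 else if ~~ inversion w i m then 0 else
    if pivot i m is Some j
    then - \sum_(l : 'I_n | (l < j)%N) shifted Y i l * (\adj Y) l j
    else free_mx y i m.

(** The order of solving: rows from the bottom up, each from left to right. *)
Definition entry_rank i m : nat := ((n - i.+1) * n + m)%N.

Lemma entry_rank_lt i m : (entry_rank i m < n * n)%N.
Proof.
have := ltn_ord i; have := ltn_ord m; rewrite /entry_rank => mn ni.
have : ((n - i.+1).+1 * n <= n * n)%N by rewrite leq_mul2r; apply/orP; right; lia.
by rewrite mulSn; lia.
Qed.

Lemma entry_rank_row i a m b : (i < a)%N -> (entry_rank a b < entry_rank i m)%N.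
Proof.
have := ltn_ord a; have := ltn_ord b; rewrite /entry_rank => bn an ia.
have : ((n - a.+1).+1 * n <= (n - i.+1) * n)%N by rewrite leq_mul2r; apply/orP; right; lia.
by rewrite mulSn; lia.
Qed.

Definition agree k Y Y' : Prop :=
  forall a b, (entry_rank a b < k)%N -> Y a b = Y' a b.

Lemma solve_step_unip y Y : unip (solve_step y Y).
Proof.
split=> [i|i j ij]; rewrite mxE ?eqxx// (negPf ij).
by case: (inversion w i j); rewrite //= eqxx.
Qed.

(** From Y^-1 - Y'^-1 = Y^-1 (Y' - Y) Y'^-1: row a of Y^-1 is supported on columns l >= a, and rows
    l > i of Y' - Y vanish. *)
Lemma invmx_rows_below i Y Y' : unip Y -> unip Y' ->
  (forall a b, (i < a)%N -> Y a b = Y' a b) ->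
  forall a b, (i < a)%N -> invmx Y a b = invmx Y' a b.
Proof.
move=> UY UY' YY' a b ia; have Yu := unip_unitmx UY; have Yu' := unip_unitmx UY'.
have -> : invmx Y = invmx Y' + invmx Y *m (Y' - Y) *m invmx Y'.
  rewrite mulmxBr mulmxBl -mulmxA mulmxV// mulmx1 mulVmx// mul1mx.
  by rewrite addrC subrK.
rewrite mxE [X in _ + X]mxE big1 ?addr0// => c _; rewrite mxE big1 ?mul0r// => l _.
have [la|al] := ltnP l a.
  by rewrite (elimT (upper_mxP _) (unip_up (unip_invmx UY)))// mul0r.
by rewrite !mxE YY' ?subrr ?mulr0// (leq_trans ia).
Qed.

(** The new entry (i, m) depends only on earlier ones: for l < j, sh l < sh j = m lies to the left
    in row i, and a nonzero term needs i <= sh l < l, so that row l of the inverse is determined by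
    the rows below i. *)
Lemma solve_step_agree y k Y Y' : unip Y -> unip Y' -> agree k Y Y' ->
  agree k.+1 (solve_step y Y) (solve_step y Y').
Proof.
move=> UY UY' YY' i m; rewrite ltnS => imk; rewrite !mxE.
case: ifP => // _; case: ifP => // _; case piv: (pivot i m) => [j|//].
have [shj cij] := pivot_Some piv.
congr (- _); apply: eq_bigr => l lj; rewrite (unip_adj UY) (unip_adj UY').
case shl: (sh l) => [a|]; last by rewrite /shifted shl !mul0r.
have am := sh_mono shl shj lj.
have [ai|ia] := ltnP a i; first by rewrite !(shifted_lt _ shl ai)// !mul0r.
rewrite /shifted shl /= YY'; last first.
  by apply: leq_trans imk; rewrite /entry_rank ltn_add2l.
congr (_ * _); apply: (@invmx_rows_below i) => //; last exact: leq_ltn_trans (sh_lt shl).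
by move=> c b ic; apply: YY'; apply: leq_trans imk; exact: entry_rank_row.
Qed.

(** Each iteration makes the next entry in the order of [entry_rank] final, so n * n iterations
    reach the fixed point from any start in U_w. Their number does not depend on [y], which keeps
    the result polynomial. *)
Definition solve y : 'M[K]_n := iter (n * n) (solve_step y) 1%:M.

Lemma unip1 : unip (1%:M : 'M[K]_n).
Proof.
by split=> [i|i j ij]; rewrite mxE ?eqxx// (negPf ij) mulr0n eqxx.
Qed.

Lemma iter_solve_step_unip y k : unip (iter k (solve_step y) 1%:M).
Proof. by case: k => [|k]; [exact: unip1|exact: solve_step_unip]. Qed.

Lemma solve_unip y : unip (solve y).
Proof. exact: iter_solve_step_unip. Qed.

Lemma solve_fixed y : solve_step y (solve y) = solve y.
Proof.
have stable k : agree k (iter k (solve_step y) 1%:M) (iter k.+1 (solve_step y) 1%:M).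
  elim: k => [//|k IHk]; rewrite [iter k.+2 _ _]iterS iterS.
  by apply: solve_step_agree IHk; exact: iter_solve_step_unip.
by apply/matrixP => a b; rewrite [RHS]stable// entry_rank_lt.
Qed.

Lemma solve_unique y Y : unip Y -> solve_step y Y = Y -> solve y = Y.
Proof.
move=> UY YE; have stable k : agree k (iter k (solve_step y) 1%:M) Y.
  elim: k => [//|k IHk]; rewrite iterS -YE.
  by apply: solve_step_agree IHk => //; exact: iter_solve_step_unip.
by apply/matrixP => a b; rewrite stable// entry_rank_lt.
Qed.

Lemma solve_free y s : solve y (enum_val s).1 (enum_val s).2 = y 0 s.
Proof.
have := enum_valP s; rewrite inE => /andP[sinv /eqP spiv].
rewrite -solve_fixed mxE sinv spiv free_mxE ifF//.
by apply/negbTE; rewrite -val_eqE ltn_eqF// (inversion_ltn sinv).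
Qed.

Lemma solve_conditions y i j : (i, j) \in conditions -> orbit_entry (solve y) i j = 0.
Proof.
move=> cij; have [m shj _] := conditionsP _ _ cij.
have invim := conditions_inversion cij shj.
have US := solve_unip y; rewrite orbit_entryE// {1}/shifted shj /=.
rewrite -{1}solve_fixed mxE invim (pivotP shj cij) ifF /=; last first.
  by apply/negbTE; rewrite -val_eqE ltn_eqF// (inversion_ltn invim).
by rewrite (unip_adj US) addNr.
Qed.

Lemma solve_surj Y : unip Y ->
  (forall i j, (i, j) \in conditions -> orbit_entry Y i j = 0) ->
  solve (\row_s Y (enum_val s).1 (enum_val s).2) = Y.
Proof.
move=> UY Yc; apply: solve_unique => //; apply/matrixP => i m; rewrite mxE.
have [<-|im] := eqVneq i m; first by case: UY.
have [wim|nw] /= := boolP (inversion w i m); last first.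
  by apply/esym/eqP; apply: contraNT nw; case: UY => _; exact.
case piv: (pivot i m) => [j|].
  have [shj cij] := pivot_Some piv; have := Yc i j cij.
  rewrite orbit_entryE// {1}/shifted shj /= (unip_adj UY) => /eqP.
  by rewrite addr_eq0 => /eqP ->.
have fim : (i, m) \in free_roots by rewrite inE wim piv /=.
have [s sE] : exists s : 'I_#|free_roots|, enum_val s = (i, m).
  by exists (enum_rank_in fim (i, m)); rewrite enum_rankK_in.
by have := free_mxE (\row_s Y (enum_val s).1 (enum_val s).2) s; rewrite [in RHS]mxE sE.
Qed.

Lemma polyfun_solve i j :
  polyfun (fun (y : 'rV[K]_#|free_roots|) s => y 0 s) (fun y => solve y i j).
Proof.
have algP := polyfun_algebra (fun (y : 'rV[K]_#|free_roots|) s => y 0 s).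
have [polyC polyD polyM] := algP.
rewrite /solve; elim: (n * n)%N i j => [|k IHk] i j; first exact: polyC.
pose Yk y := iter k (solve_step y) 1%:M.
rewrite (_ : (fun y => _) = fun y =>
  if i == j then 1 else if ~~ inversion w i j then 0 else
  if pivot i j is Some m
  then - \sum_(l : 'I_n | (l < m)%N) shifted (Yk y) i l * (\adj (Yk y)) l m
  else free_mx y i j); last by apply/funext => y; rewrite iterS mxE.
case: (i == j); first exact: polyC.
case: (inversion w i j); last exact: polyC.
case: (pivot i j) => [m|].
  apply: (function_algebra_opp algP); apply: (function_algebra_sum algP) => l.
  apply: polyM; last exact: (function_algebra_adj algP).
  by rewrite /shifted; case: (sh l) => [a|] /=; [exact: IHk|exact: polyC].
rewrite (_ : (fun y => _) = fun y : 'rV[K]_#|free_roots| =>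
  \sum_s y 0 s * (enum_val s == (i, j))%:R); last first.
  by apply/funext => y; rewrite mxE; apply: eq_bigr => s _; rewrite mulr_natr.
apply: (function_algebra_sum algP) => s.
by apply: polyM; [exact: polyfun_coord|exact: polyC].
Qed.

(** Identifies the conditions with the roots that the dimension formula subtracts: a nontrivial
    equation is one whose entry is nonzero somewhere on the orbit. *)
Lemma mem_conditionsP (a : 'I_n * 'I_n) : a \in conditions <->
  ~~ alw a.1 a.2 /\ exists2 Y, unip Y & orbit_entry Y a.1 a.2 != 0.
Proof.
case: a => i j /=; split=> [cij|[nij [Y UY]]]; last exact: orbit_entry_neq0.
have /conditionsP[m shj /andP[nij im]] := cij; split=> //.
have invim := conditions_inversion cij shj.
(* This makes the leading term Y_im equal to 1. The other terms vanish: below row i the inverse of Y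
   agrees with the identity, and for l <= i either sh l < i or it is undefined. *)
pose Y : 'M[K]_n := 1%:M + delta_mx i m.
have YE a b : Y a b = (a == b)%:R + ((a == i) && (b == m))%:R by rewrite !mxE.
have UY : unip Y.
  split=> [a|a b ab]; rewrite YE.
    rewrite eqxx (_ : _ && _ = false) ?addr0//.
    by apply/negP => /andP[/eqP -> /eqP ie]; rewrite -ie ltnn in im.
  rewrite (negPf ab) add0r; case: (@andP (a == i)) => [[/eqP -> /eqP ->]//|_].
  by rewrite eqxx.
exists Y => //; rewrite orbit_entryE// {1}/shifted shj /= YE !eqxx /=.
rewrite -val_eqE ltn_eqF// add0r big1 ?addr0 ?oner_eq0// => l lj.
have [il|li] := ltnP i l.
  have -> : invmx Y l j = 0; last by rewrite mulr0.
  have -> : invmx Y l j = invmx 1%:M l j.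
    apply: (@invmx_rows_below i) => //; first exact: unip1.
    by move=> a b ia; rewrite YE [in RHS]mxE -[a == i]val_eqE gtn_eqF// addr0.
  by rewrite invmx1 mxE -val_eqE ltn_eqF.
case shl: (sh l) => [a|]; last by rewrite /shifted shl mul0r.
by rewrite (shifted_lt UY shl) ?mul0r// (leq_trans (sh_lt shl)).
Qed.

End ShiftElimination.

(** * Nilpotent Jordan forms *)

Section JordanShift.
Variables (K : fieldType).

Lemma upper_exp_diag n (A : 'M[K]_n) k i : upper_mx A ->
  upper_mx (A ^+ k) /\ (A ^+ k) i i = A i i ^+ k.
Proof.
move=> Aup; elim: k => [|k [IHup IHd]].
  rewrite !expr0; split; last by rewrite -[1]/(1%:M) mxE eqxx.
  by rewrite -[1]/(1%:M) -diag_const_mx upper_diag_mx.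
rewrite !exprS; split; first exact: upper_mulmx.
by rewrite -IHd; exact: upper_diag_mulmx.
Qed.

Lemma nilpotent_upper_diag n (A : 'M[K]_n) i : upper_mx A -> nilpotent_mx A -> A i i = 0.
Proof.
move=> Aup [k Ak]; have [_ Aik] := upper_exp_diag k i Aup.
by apply/eqP; have := Aik; rewrite Ak mxE => /esym/eqP; rewrite expf_eq0 => /andP[].
Qed.

(* [p t] is the position of the t-th basis vector in its Jordan block. *)
Lemma nilpotent_jordan_form n (J : 'M[K]_n) : jordan_form J -> nilpotent_mx J ->
  exists p : 'I_n -> nat,
  [/\ forall s t, J s t = ((t == s.+1 :> nat) && (0 < p t)%N)%:R,
      forall s t : 'I_n, t = s.+1 :> nat -> (0 < p t)%N -> p t = (p s).+1
    & forall t, (p t <= t)%N].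
Proof.
move=> [r [m [lambda [e [_ ->]]]]] {J}; case: n / e.
rewrite castmx_id => Jnil; set J := \mxdiag_i _ in Jnil *.
pose p t : nat := @tagnat.sig2 r m t; pose c t := @tagnat.sig1 r m t.
pose off (i : 'I_r) := (\sum_(l < r | (l < i)%N) m l)%N.
have rectE (t : 'I_(\sum_i m i)) : t = (off (c t) + p t)%N :> nat by exact: tagnat.rect.
(* Away from the start of a block, the preceding index is the preceding position of the same
   block. *)
have sameblock (s t : 'I_(\sum_i m i)) : t = s.+1 :> nat -> (0 < p t)%N -> c s = c t.
  move=> ts pt; have pt' : ((p t).-1 < m (c t))%N.
    by apply: leq_ltn_trans (leq_pred _) _; exact: ltn_ord.
  suff -> : s = tagnat.Rank (c t) (Ordinal pt') by exact: tagnat.Rank1K.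
  apply: val_inj; rewrite [RHS]tagnat.RankEsum /= -/(off (c t)).
  move: pt {pt'} (rectE t); rewrite ts.
  by move: (off _) (p t) (nat_of_ord s) => x y z; lia.
have pS (s t : 'I_(\sum_i m i)) : t = s.+1 :> nat -> (0 < p t)%N -> p t = (p s).+1.
  move=> ts pt; have cst := sameblock s t ts pt.
  move: (rectE t) (rectE s); rewrite cst ts.
  by move: (off _) (p t) (p s) (nat_of_ord s) => x y z u; lia.
have eqblock s t : (c s == c t) && (p s == p t) = (s == t).
  by rewrite -val_eqE -tagnat.eq_Rank !tagnat.sig2K.
have sucblock (s t : 'I_(\sum_i m i)) : (c s == c t) && (p t == (p s).+1) =
    (t == s.+1 :> nat) && (0 < p t)%N.
  apply/andP/andP => [[/eqP cst /eqP pst]|[/eqP ts pt]]; last first.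
    by split; apply/eqP; [exact: sameblock ts pt|exact: pS ts pt].
  rewrite pst; split=> //; apply/eqP.
  move: (rectE t) (rectE s); rewrite cst pst.
  by move: (off _) (p s) (nat_of_ord s) (nat_of_ord t) => x y z u; lia.
have JE (s t : 'I_(\sum_i m i)) : J s t = lambda (c s) *+ (s == t) + ((t == s.+1 :> nat) && (0 < p t)%N)%:R.
  rewrite -eqblock -sucblock mxE -/(c s) -/(c t) /p.
  move: (tagnat.sig2 s) (tagnat.sig2 t); rewrite -/(c s) -/(c t).
  move: (c s) (c t) => i j a b; have [ij|ij] := eqVneq i j; last first.
    by rewrite mxE mulr0n addr0.
  by case: j / ij b => b; rewrite conform_mx_id mxE.
have Jup : upper_mx J.
  apply/upper_mxP => s t ts; rewrite JE -val_eqE /= gtn_eqF// mulr0n add0r.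
  by rewrite ltn_eqF// ltnW.
exists p; split=> // [s t|t]; last first.
  by rewrite [X in (_ <= X)%N]rectE leq_addl.
(* The diagonal entry at s is the eigenvalue of its block, which nilpotency forces to be 0. *)
rewrite JE; have := nilpotent_upper_diag s Jup Jnil.
rewrite JE eqxx mulr1n ltn_eqF// addr0 => ->.
by rewrite mul0rn add0r.
Qed.

End JordanShift.

(** * Sorting a Jordan basis by position in the blocks *)

Section SortingJordanBasis.
Variables (n : nat) (p : 'I_n -> nat).
Hypothesis p_suc : forall s t : 'I_n, t = s.+1 :> nat -> (0 < p t)%N -> p t = (p s).+1.
Hypothesis p_le : forall t, (p t <= t)%N.

(* Encodes the lexicographic order on (p t, t). *)
Definition jordan_key (t : 'I_n) : nat := (p t * n + t)%N.

Lemma jordan_key_inj : injective jordan_key.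
Proof.
move=> s t st; apply: val_inj => /=.
have modE (u : 'I_n) : (jordan_key u %% n)%N = u by rewrite modnMDl modn_small.
by rewrite -(modE s) st modE.
Qed.

(** The new index of t is the number of smaller keys. *)
Lemma exists_sorting_perm : exists sigma : 'S_n,
  forall s t, (sigma s < sigma t)%N = (jordan_key s < jordan_key t)%N.
Proof.
pose below t := [set s | (jordan_key s < jordan_key t)%N]%SET.
have below_lt t : (#|below t| < n)%N.
  rewrite -[X in (_ < X)%N](card_ord n) -cardsT; apply: proper_card.
  rewrite properT; apply/eqP => /setP/(_ t); by rewrite !inE ltnn.
pose f t := Ordinal (below_lt t).
have mono s t : (jordan_key s < jordan_key t)%N -> (f s < f t)%N.
  move=> st; apply: proper_card; apply/properP; split.
    by apply/fintype.subsetP => u; rewrite !inE => /ltn_trans; apply.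
  by exists s; rewrite !inE ?ltnn.
have f_inj : injective f.
  move=> s t fst; apply: jordan_key_inj; apply/eqP.
  by case: ltngtP => // /mono; rewrite fst ltnn.
exists (perm f_inj) => s t; rewrite !permE; apply/idP/idP => [st|]; last exact: mono.
rewrite ltnNge leq_eqVlt; apply/negP => /orP[/eqP/jordan_key_inj ts|/mono ts].
  by rewrite ts ltnn in st.
by have := ltn_trans st ts; rewrite ltnn.
Qed.

Variable sigma : 'S_n.
Hypothesis sigma_mono :
  forall s t, (sigma s < sigma t)%N = (jordan_key s < jordan_key t)%N.

Definition jordan_shift (j : 'I_n) : option 'I_n :=
  [pick i | (sigma^-1%g j == (sigma^-1%g i).+1 :> nat) && (0 < p (sigma^-1%g j))%N].

Lemma jordan_shiftP i j : (jordan_shift j == Some i) =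
  (sigma^-1%g j == (sigma^-1%g i).+1 :> nat) && (0 < p (sigma^-1%g j))%N.
Proof.
rewrite /jordan_shift; case: pickP => [l /andP[/eqP jl pj]|/(_ i) -> //].
rewrite pj andbT jl eqSS val_eqE (inj_eq perm_inj).
by apply/eqP/eqP => [[->]|->].
Qed.

(** Both p and the index drop by one, so the key drops by the constant n + 1. Hence the shift is
    decreasing and preserves the order. *)
Lemma jordan_shift_Some i j : jordan_shift j = Some i ->
  jordan_key (sigma^-1%g j) = (jordan_key (sigma^-1%g i) + n.+1)%N.
Proof.
move=> /eqP; rewrite jordan_shiftP => /andP[/eqP ji pj].
by rewrite /jordan_key (p_suc ji pj) ji mulSn; lia.
Qed.

Lemma jordan_key_ltn (i j : 'I_n) :
  (i < j)%N = (jordan_key (sigma^-1%g i) < jordan_key (sigma^-1%g j))%N.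
Proof. by rewrite -sigma_mono !permKV. Qed.

Lemma jordan_shift_lt i j : jordan_shift j = Some i -> (i < j)%N.
Proof. by move=> /jordan_shift_Some; rewrite jordan_key_ltn => ->; lia. Qed.

Lemma jordan_shift_mono a b l j : jordan_shift l = Some a ->
  jordan_shift j = Some b -> (l < j)%N -> (a < b)%N.
Proof.
move=> /jordan_shift_Some lE /jordan_shift_Some jE.
by rewrite !jordan_key_ltn lE jE ltn_add2r.
Qed.

(** The shift is undefined exactly where p = 0; those keys are below n, all others at least n. *)
Lemma jordan_shift_up a (l j : 'I_n) : jordan_shift l = Some a -> (l < j)%N ->
  jordan_shift j != None.
Proof.
move=> /eqP; rewrite jordan_shiftP jordan_key_ltn => /andP[_ pl] lj.
have pj : (0 < p (sigma^-1%g j))%N.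
  rewrite lt0n; apply: contraTneq lj => pj; rewrite -leqNgt /jordan_key pj mul0n.
  apply: ltnW; apply: leq_trans (ltn_ord _) _; apply: leq_trans (leq_addr _ _).
  by rewrite leq_pmull.
have jgt0 := leq_trans pj (p_le _).
have i_lt : ((sigma^-1%g j).-1 < n)%N by rewrite (leq_ltn_trans (leq_pred _)).
have : jordan_shift j == Some (sigma (Ordinal i_lt)).
  by rewrite jordan_shiftP permK /= prednK// eqxx.
by move=> /eqP ->.
Qed.

End SortingJordanBasis.

(** * The paving *)

Section SchubertUnions.
Variables (K : fieldType) (n : nat) (k : linear_group) (Q : 'M[K]_n).
Hypothesis Qu : Q \in unitmx.

Lemma corank_coset p q g h : group_set k g -> coset k Q g = coset k Q h ->
  corank p q (coords Q g) = corank p q (coords Q h).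
Proof.
move=> Gg /(eq_coset Qu)[b [Gb bup] ->]; rewrite coords_mul//.
rewrite -[coords Q g *m _]mul1mx mulmxA [RHS]corank_borel ?unitmx1//.
  by rewrite -diag_const_mx upper_diag_mx.
by rewrite unitmx_coords//; exact: group_set_unitmx Gb.
Qed.

Lemma schubert_cell_corank w x g p q : schubert_cell k Q w x ->
  group_set k g -> x = coset k Q g ->
  corank p q (coords Q g) = corank p q (perm_mx w^-1 : 'M[K]_n).
Proof.
move=> /(schubert_cell_coordsP k Qu)[h [B1 [B2 [Gh -> [? ?] [? ?] hE]]]] Gg hg.
by rewrite -(corank_coset p q Gh hg) hE corank_borel.
Qed.

Lemma schubert_cell_cover x : points (flag_variety k Q) x ->
  exists w, schubert_cell k Q w x.
Proof.
move=> [g [_ Gg] <-].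
have gu : coords Q g \in unitmx by rewrite unitmx_coords//; exact: group_set_unitmx Gg.
have [w [B1 [B2 [B1up B1u B2up B2u gE]]]] := bruhat gu.
by exists w; apply/(schubert_cell_coordsP k Qu); exists g, B1, B2.
Qed.

Lemma schubert_cell_point w x : schubert_cell k Q w x ->
  exists2 g, group_set k g & x = coset k Q g.
Proof. by move=> /(schubert_cell_coordsP k Qu)[g [_ [_ [Gg -> _ _ _]]]]; exists g. Qed.

(** The set consists of the cells of [r] and those below them in the rank order. It is closed
    upstairs by vanishing of minors, and corner ranks do not depend on the representative of a
    coset. *)
Lemma zclosed_corank_le (r : seq 'S_n) :
  zclosed (flag_variety k Q) [set x | exists g, [/\ group_set k g, x = coset k Q g
    & exists2 v, v \in r & forall p q : 'I_n.+1,
        (corank p q (coords Q g) <= corank p q (perm_mx v^-1 : 'M[K]_n))%N]].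
Proof.
split; first by move=> _ [g [Gg -> _]]; exists g.
pose Zv v := [set A : 'M[K]_n | forall pq : 'I_n.+1 * 'I_n.+1,
  (corank pq.1 pq.2 (coords Q A) <= corank pq.1 pq.2 (perm_mx v^-1 : 'M[K]_n))%N].
exists [set A | exists2 v, v \in r & Zv v A].
  apply: zclosed_coordinate_bigcup => v.
  apply: zclosed_coordinate_bigcap => pq; apply: zclosed_rank_le.
  have algP := polyfun_algebra (fun (A : 'M[K]_n) l => mxvec A 0 l).
  have [polyC _ _] := algP.
  apply: (function_algebra_mulmx algP) => [|i j]; last exact: polyC.
  apply: (function_algebra_mulmx algP) => i j; first exact: polyC.
  exact: polyfun_coords.
apply/seteqP; split=> A /=.
  move=> [[_ GA] [g [Gg /esym gA [v rv gv]]]]; split=> //.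
  by exists v => // pq; rewrite -(corank_coset _ _ Gg gA); exact: gv.
move=> [GA [v rv Av]]; split=> //; exists A; split=> //.
by exists v => // p q; exact: (Av (p, q)).
Qed.

End SchubertUnions.

Section Paving.
Variables (K : numFieldType) (n : nat) (k : linear_group) (Q N : 'M[K]_n).
Variable sh : 'I_n -> option 'I_n.
Hypothesis Qu : Q \in unitmx.
Hypothesis lieN : lie_algebra k N.
Hypothesis sh_lt : forall i j, sh j = Some i -> (i < j)%N.
Hypothesis sh_mono : forall a b l j,
  sh l = Some a -> sh j = Some b -> (l < j)%N -> (a < b)%N.
Hypothesis sh_up : forall a (l j : 'I_n), sh l = Some a -> (l < j)%N -> sh j != None.
Hypothesis N_sh : coords Q N = \matrix_(i, j) (sh j == Some i)%:R.
Variable H : {vspace 'M[K]_n}.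
Hypothesis hessH : hessenberg_space k Q H.

Let HNH := hessenberg_variety k Q N H.
Let X := subspace (flag_variety k Q) HNH.
Let cell w := schubert_cell k Q w `&` HNH.

Let orbitE Y i j : (Y *m coords Q N *m invmx Y) i j = orbit_entry sh Y i j.
Proof. by rewrite /orbit_entry N_sh. Qed.

Let N_neq0 i j : (coords Q N i j != 0) = (sh j == Some i).
Proof. by rewrite N_sh mxE pnatr_eq0 eqb0 negbK. Qed.

Lemma exists_torus (w : 'S_n) : exists2 t : 'rV[K]_n, forall i, t 0 i != 0 &
  \det (perm_mx w^-1 : 'M[K]_n) * \det (diag_mx t) = 1.
Proof. by apply: exists_diag_det; exact: unitmx_perm. Qed.

Lemma cell_point_hessenbergP w (t : 'rV[K]_n) Y : (forall i, t 0 i != 0) ->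
  \det (perm_mx w^-1 : 'M[K]_n) * \det (diag_mx t) = 1 ->
  unipotent_on (inversion w) Y ->
  HNH (coset k Q (cell_point Q w t (invmx Y))) <->
  forall i j, orbit_entry sh Y i j != 0 -> allowed_by Q H w i j.
Proof.
move=> t0 dt UY; have UZ := unip_invmx UY.
rewrite /HNH (cell_point_hessenberg Qu hessH lieN t0 (group_set_cell_point k Qu dt UZ) (unip_unitmx UZ)).
by rewrite invmxK; split=> Yall i j; [rewrite -orbitE|rewrite orbitE]; exact: Yall.
Qed.

(** Every conjugate of N by U_w has entry 1 at the positions (sh j, j), so these must be allowed;
    conversely, they are all that u = 1 requires. *)
Lemma cell_nonemptyP w :
  cell w !=set0 <-> forall i j, sh j = Some i -> allowed_by Q H w i j.
Proof.
have [t t0 dt] := exists_torus w; split=> [[x []]|shall].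
  move=> /(schubert_cellP k Qu t0 dt)[u Uu ->]; rewrite -[u]invmxK.
  have Uu' := unip_invmx Uu.
  move=> /(cell_point_hessenbergP t0 dt Uu') uall i j shj; apply: uall.
  by rewrite (orbit_entry_sh sh_mono sh_up Uu' shj) oner_eq0.
have U1 : unipotent_on (inversion w) (1%:M : 'M[K]_n) by exact: unip1.
exists (coset k Q (cell_point Q w t (invmx 1%:M))); split.
  by apply/(schubert_cellP k Qu t0 dt); exists (invmx 1%:M) => //; exact: unip_invmx.
apply/(cell_point_hessenbergP t0 dt U1) => i j.
by rewrite -orbitE invmx1 mul1mx mulmx1 N_neq0 => /eqP; exact: shall.
Qed.

Lemma cell_nonempty_weyl w :
  cell w !=set0 <-> Ad (invmx (weyl_mx Q w)) N \in H.
Proof.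
rewrite cell_nonemptyP (weyl_mem_hessenberg Qu hessH lieN).
split=> Nall i j; first by rewrite N_neq0 => /eqP; exact: Nall.
by move=> /eqP; rewrite -N_neq0; exact: Nall.
Qed.

Section Cell.
Variable w : 'S_n.
Hypothesis alw_sh : forall i j, sh j = Some i -> allowed_by Q H w i j.

Let alw := allowed_by Q H w.

Let alw_left (i m j : 'I_n) : (i < m)%N -> ~~ inversion w i m -> alw m j -> alw i j.
Proof.
move=> im; rewrite /inversion im -leqNgt => wim mj.
exact: (allowed_up Qu hessH mj wim).
Qed.

Lemma cell_isomorphic :
  isomorphic (subspace X (cell w)) (affine_space K #|free_roots w sh alw|).
Proof.
have [t t0 dt] := exists_torus w.
have solve_U (y : 'rV[K]_#|free_roots w sh alw|) : unipotent_on (inversion w) (solve y).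
  exact: solve_unip.
apply: (schubert_slice_iso Qu (Yp := @solve K n w sh alw) t0 dt).
- exact: polyfun_solve.
- exact: solve_U.
- move=> y; apply/(cell_point_hessenbergP t0 dt (solve_U y)).
  apply/(orbit_allowedP sh_mono sh_up alw_sh (solve_U y)) => i j.
  exact: solve_conditions.
- exact: solve_free.
- move=> Y UY /(cell_point_hessenbergP t0 dt UY).
  move=> /(orbit_allowedP sh_mono sh_up alw_sh UY).
  exact: solve_surj.
Qed.

Lemma card_free_rootsE : #|free_roots w sh alw|%:Z = #|Phi_perm k Q w|%:Z -
  #|(C_perm k Q w H :&: Phi_of_set Q [set Ad u N | u in U_perm k Q w])%SET|%:Z.
Proof.
have -> : #|Phi_perm k Q w| = (#|free_roots w sh alw| + #|conditions sh alw|)%N.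
  rewrite card_free_roots//; apply: eq_card => a.
  by rewrite mem_Phi_perm// inE.
rewrite (_ : (_ :&: _)%SET = conditions sh alw) ?PoszD ?addrK//.
apply/setP => a; rewrite inE mem_C_perm//; apply/andP/idP.
  move=> [/andP[_ nalw] /(mem_Phi_of_orbit k Qu)[_ [Y UY Ya]]].
  apply/(mem_conditionsP K sh_lt sh_mono sh_up alw_sh alw_left); split=> //.
  by exists Y => //; rewrite -orbitE.
move=> ac; have [m sha /andP[nalw am]] := conditionsP _ _ _ _ (etrans (congr1 _ (esym (surjective_pairing a))) ac).
have alt := ltn_trans am (sh_lt sha); split; first by rewrite alt.
have [_ [Y UY Ya]] := (mem_conditionsP K sh_lt sh_mono sh_up alw_sh alw_left a).1 ac.
apply/(mem_Phi_of_orbit k Qu); split; first by rewrite -val_eqE ltn_eqF.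
by exists Y => //; rewrite orbitE.
Qed.

End Cell.

Lemma cell_affine w : cell w !=set0 -> exists d : nat,
  isomorphic (subspace X (cell w)) (affine_space K d) /\
  d%:Z = #|Phi_perm k Q w|%:Z -
    #|(C_perm k Q w H :&: Phi_of_set Q [set Ad u N | u in U_perm k Q w])%SET|%:Z.
Proof.
move=> /cell_nonemptyP alw_sh; exists #|free_roots w sh (allowed_by Q H w)|.
by split; [exact: cell_isomorphic|exact: card_free_rootsE].
Qed.

Lemma cell_paving : exists (m : nat) (s : 'I_m -> 'S_n),
  [/\ injective s, forall w, (exists i, s i = w) <-> cell w !=set0
    & paving_by_affines X (fun i => cell (s i))].
Proof.
pose key := @corank_sum K n.
pose W := sort (relpre key leq) [seq w <- enum {: 'S_n} | `[< cell w !=set0 >]].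
have memW w : (w \in W) = `[< cell w !=set0 >].
  by rewrite mem_sort mem_filter mem_enum andbT.
have Wuniq : uniq W by rewrite sort_uniq filter_uniq// enum_uniq.
pose s (i : 'I_(size W)) := nth 1%g W i.
have s_inj : injective s.
  by move=> i j /eqP; rewrite nth_uniq// => /eqP/val_inj.
have sP w : (exists i, s i = w) <-> cell w !=set0.
  split=> [[i <-]|/asboolP]; first by apply/asboolP; rewrite -memW mem_nth.
  rewrite -memW => wW; have iW : (index w W < size W)%N by rewrite index_mem.
  by exists (Ordinal iW); rewrite /s nth_index.
have s_mono (i j : 'I_(size W)) : (i <= j)%N -> (key (s i) <= key (s j))%N.
  move=> ij; have W_sorted : sorted (relpre key leq) W.
    by apply: sort_sorted => a b; exact: leq_total.
  apply: (sorted_leq_nth _ _ _ W_sorted) => //; rewrite ?inE//.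
  - by move=> a b c; exact: leq_trans.
  - by move=> a /=.
have cell_pt w x : cell w x -> exists2 g, group_set k g & x = coset k Q g.
  by move=> [/(schubert_cell_point Qu)].
have cover x : points X x -> exists i, cell (s i) x.
  move=> [Fx Hx]; have [w wx] := schubert_cell_cover Qu Fx.
  have /sP[i iw] : cell w !=set0 by exists x.
  by exists i; rewrite iw.
(* The strict bound serves twice: the cell i is the difference of the sets for c = i + 1 and c = i,
   hence locally closed. *)
have closedU (c : nat) : zclosed X [set x | exists2 i : 'I_(size W), (i < c)%N & cell (s i) x].
  pose r := [seq s i | i : 'I_(size W) <- enum 'I_(size W) & (i < c)%N].
  apply: (ex_intro2 _ _ _ (zclosed_corank_le k Qu r)).
  apply/seteqP; split=> x /=.
    move=> [i ic six]; have [g Gg xg] := cell_pt _ _ six.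
    split; first by case: six.
    exists g; split=> //; exists (s i); first by rewrite map_f// mem_filter ic mem_enum.
    by move=> p q; rewrite (schubert_cell_corank Qu p q six.1 Gg xg).
  (* A point within the rank bounds of [s j] lies in a cell [s i] with ranks no larger, so either s
     i = s j or the key of [s i] is strictly smaller and i comes before j. *)
  move=> [Hx [g [Gg xg [v /mapP[j + ->] gv]]]]; rewrite mem_filter => /andP[jc _].
  have [i six] : exists i, cell (s i) x.
    by apply: cover; split=> //; exists g.
  have ij p q := esym (schubert_cell_corank Qu p q six.1 Gg xg).
  have [ji|lij] := leqP (key (s j)) (key (s i)).
    exists j => //; suff <- : s i = s j by [].
    by apply: (@corank_sum_inj K) => // p q; rewrite ij.
  exists i => //; apply: leq_trans jc; rewrite ltnS leqNgt; apply/negP => /ltnW/s_mono.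
  by rewrite leqNgt lij.
have disjoint v w x : cell v x -> cell w x -> v = w.
  move=> vx wx; have [g Gg xg] := cell_pt _ _ vx.
  apply: (@corank_perm_inj K) => p q.
  by rewrite -(schubert_cell_corank Qu p q vx.1 Gg xg) (schubert_cell_corank Qu p q wx.1 Gg xg).
exists (size W), s; split=> //; split; last first.
  move=> i; have /cell_affine[d [iso _]] : cell (s i) !=set0 by apply/sP; exists i.
  by exists d.
split.
- apply/seteqP; split=> [x /cover[i ix]|x [i _ ix]]; first by exists i.
  have [g Gg xg] := cell_pt _ _ ix; split; last by case: ix.
  by exists g.
- by move=> i j _ _ [x [ix jx]]; apply/s_inj/(disjoint _ _ x).
- by move=> i; apply/sP; exists i.
- move=> i; exists [set x | exists2 j : 'I_(size W), (j < i.+1)%N & cell (s j) x],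
    [set x | exists2 j : 'I_(size W), (j < i)%N & cell (s j) x].
  split; [exact: closedU|exact: closedU|apply/seteqP; split=> x /=].
    move=> ix; split; first by exists i.
    by move=> [j ji jx]; move: ji; rewrite (s_inj _ _ (disjoint _ _ _ ix jx)) ltnn.
  move=> [[j + jx] nlt]; rewrite ltnS leq_eqVlt => /orP[/eqP/val_inj <-//|ji].
  by case: nlt; exists j.
- move=> i; apply: (eq_zclosed (closedU i.+1)); apply/seteqP.
  by split=> x /= [j ji jx]; exists j.
Qed.

End Paving.

Section PermutedBasis.
Variables (K : fieldType) (n : nat) (P : 'M[K]_n) (sigma : 'S_n).
Hypothesis Pu : P \in unitmx.

Lemma permute_basisE : permute_basis P sigma = P *m perm_mx sigma.
Proof.
have wu : weyl_mx P sigma \in unitmx.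
  by rewrite -(unitmx_coords _ Pu) coords_weyl_mx// unitmx_perm.
rewrite /permute_basis -[invmx _](Ad_coords _ Pu) coords_invmx// coords_weyl_mx//.
by rewrite invmx_perm_mxV /Ad mulmxKV.
Qed.

Lemma permute_basis_unitmx : permute_basis P sigma \in unitmx.
Proof. by rewrite permute_basisE unitmx_mul Pu unitmx_perm. Qed.

Lemma coords_permute_basis A i j : coords (permute_basis P sigma) A i j =
  coords P A (sigma^-1%g i) (sigma^-1%g j).
Proof.
have sV : invmx (perm_mx sigma) = perm_mx sigma^-1 :> 'M[K]_n.
  by rewrite -[in LHS](invgK sigma) invmx_perm_mxV.
rewrite -perm_conjE invgK permute_basisE; congr (fun_of_matrix _ i j).
by rewrite /coords invmx_mulmx ?unitmx_perm// sV !mulmxA.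
Qed.

End PermutedBasis.

Theorem theorem22 (R : realType) (n : nat) (G : linear_group)
    (N : 'M[R[i]]_n) (P : 'M[R[i]]_n) :
  lie_algebra G N -> nilpotent_mx N ->
  P \in unitmx -> jordan_form (coords P N) ->
  exists sigma : 'S_n,
    let Q := permute_basis P sigma in
    forall H : {vspace 'M[R[i]]_n}, hessenberg_space G Q H ->
      let HNH := hessenberg_variety G Q N H in
      let X := subspace (flag_variety G Q) HNH in
      let cell w := schubert_cell G Q w `&` HNH in
      [/\ exists (m : nat) (s : 'I_m -> 'S_n),
            [/\ injective s,
                forall w, (exists i, s i = w) <-> cell w !=set0
              & paving_by_affines X (fun i => cell (s i))],
          forall w, cell w !=set0 <-> Ad (invmx (weyl_mx Q w)) N \in H
        & forall w, cell w !=set0 ->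
            exists d : nat,
              isomorphic (subspace X (cell w)) (affine_space R[i] d) /\
              d%:Z = #|Phi_perm G Q w|%:Z
                     - #|(C_perm G Q w H :&:
                          Phi_of_set Q [set Ad u N | u in U_perm G Q w])%SET|%:Z].
Proof.
move=> lieN [e Ne] Pu Jform.
have coordsM A B : coords P A * coords P B = coords P (A * B).
  exact/esym/coords_mul.
have coordsX l : coords P N ^+ l = coords P (N ^+ l).
  elim: l => [|l IHl]; first by rewrite !expr0 -[1]/(1%:M) coords1.
  by rewrite !exprS IHl coordsM.
have Jnil : nilpotent_mx (coords P N).
  by exists e; rewrite coordsX Ne /coords mulmx0 mul0mx.
have [p [JE p_suc p_le]] := nilpotent_jordan_form Jform Jnil.
have [sigma sigma_mono] := exists_sorting_perm p.
exists sigma => Q H hessH HNH X cell.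
have Qu : Q \in unitmx by exact: permute_basis_unitmx.
have N_sh : coords Q N = \matrix_(i, j) (jordan_shift p sigma j == Some i)%:R.
  by apply/matrixP => i j; rewrite [RHS]mxE /Q coords_permute_basis// JE jordan_shiftP.
have sh_lt := jordan_shift_lt p_suc sigma_mono.
have sh_mono := jordan_shift_mono p_suc sigma_mono.
have sh_up := jordan_shift_up p_le sigma_mono.
split.
- exact (cell_paving Qu lieN sh_lt sh_mono sh_up N_sh hessH).
- exact (cell_nonempty_weyl Qu lieN sh_mono sh_up N_sh hessH).
- exact (cell_affine Qu lieN sh_lt sh_mono sh_up N_sh hessH).
Qed.
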